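(* Let $k\ge0$ be an integer and $1\le p\le\infty$. For $h_1,h_2,h_3>0$ let $\widetilde T=\widetilde T(h_1,h_2,h_3)$ be the tetrahedron with vertices $\mathbf{0}$, $h_1\mathbf{e}_1+h_2\mathbf{e}_2$, $h_2\mathbf{e}_2$ and $h_3\mathbf{e}_3$, let $h_T$ be its diameter, and let $\widetilde\Pi_{k,2}\widetilde{\mathbf{u}}$ denote the second component of the Raviart-Thomas interpolation of order $k$ of $\widetilde{\mathbf{u}}$ on $\widetilde T$. Then there is no constant $C$ independent of $h_1,h_2,h_3$ such that, for all $h_1,h_2,h_3>0$ and all $\widetilde{\mathbf{u}}=(\tilde u_1,\tilde u_2,\tilde u_3)\in W^{1,p}(\widetilde T)^3$, $$ \|\widetilde\Pi_{k,2}\widetilde{\mathbf{u}}\|_{L^p(\widetilde T)}\le C\left(\|\widetilde{\mathbf{u}}\|_{L^p(\widetilde T)}+\sum_{i,j=1}^3h_j\left\|\frac{\partial\tilde u_i}{\partial\tilde x_j}\right\|_{L^p(\widetilde T)}+h_T\|\mathrm{div}\,\widetilde{\mathbf{u}}\|_{L^p(\widetilde T)}\right). $$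
   Context: $\mathbf{e}_1,\mathbf{e}_2,\mathbf{e}_3$ are the canonical vectors of $\mathbb{R}^3$, and $\tilde x_1,\tilde x_2,\tilde x_3$ are the Cartesian coordinates on $\widetilde T$. Raviart-Thomas interpolation on a tetrahedron $T$: $\mathcal{P}_k(S)$ denotes the polynomials of degree at most $k$ on $S$ (with $\mathcal{P}_{-1}=\{0\}$), and $\mathcal{RT}_k(T)=\mathcal{P}_k(T)^3+(x_1,x_2,x_3)\mathcal{P}_k(T)$. For $\mathbf{u}\in W^{1,p}(T)^3$, the Raviart-Thomas interpolation $\Pi_k\mathbf{u}\in\mathcal{RT}_k(T)$ is the unique element such that $\int_F \Pi_k\mathbf{u}\cdot\mathbf{n}\,p_k=\int_F\mathbf{u}\cdot\mathbf{n}\,p_k$ for all $p_k\in\mathcal{P}_k(F)$ and every face $F$ of $T$ (with unit normal $\mathbf{n}$), and $\int_T\Pi_k\mathbf{u}\cdot\mathbf{p}_{k-1}=\int_T\mathbf{u}\cdot\mathbf{p}_{k-1}$ for all $\mathbf{p}_{k-1}\in\mathcal{P}_{k-1}(T)^3$. *)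

(* Defs.v *)
From HB Require Import structures.
From mathcomp Require Import all_boot all_order all_algebra.
(* The notations of mpoly clash with those of analysis. *)
From mathcomp Require Import -(notations) mpoly.
From mathcomp Require Import all_classical all_reals all_analysis.

Set Implicit Arguments.
Unset Strict Implicit.
Unset Printing Implicit Defensive.
Import Order.TTheory GRing.Theory Num.Theory.
Import numFieldNormedType.Exports.
Local Open Scope classical_set_scope.
Local Open Scope ring_scope.

Notation R3 R := (R * R * R)%type.

(* Coordinates are indexed from 0: the second one is [1 : 'I_3]. *)
Definition xcoord (R : realType) (i : 'I_3) (x : R3 R) : R :=
  match val i with 0 => x.1.1 | 1 => x.1.2 | _ => x.2 end.

Definition evec (R : realType) (j : 'I_3) : R3 R :=
  ((j == 0)%:R, (j == 1)%:R, (j == 2)%:R).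

(* The norm of the product type [R3 R] is the sup norm, hence this one. *)
Definition enorm (R : realType) (w : 'I_3 -> R) : R :=
  Num.sqrt (\sum_i w i ^+ 2).

Definition cross (R : realType) (u v : R3 R) : R3 R :=
  (u.1.2 * v.2 - u.2 * v.1.2,
   u.2 * v.1.1 - u.1.1 * v.2,
   u.1.1 * v.1.2 - u.1.2 * v.1.1).

Definition diam (R : realType) (A : set (R3 R)) : R :=
  sup [set enorm (fun i => xcoord i (x.1 - x.2)) | x in A `*` A].

Definition leb2 (R : realType) :
    set (measurableTypeR R * measurableTypeR R) -> \bar R :=
  (@lebesgue_measure R \x @lebesgue_measure R)%E.
HB.instance Definition _ (R : realType) := Measure.on (@leb2 R).

(* The instance of the library for [\x] is hidden by the one for probabilities. *)
Lemma leb2_sigma_finite (R : realType) : sigma_finite setT (@leb2 R).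
Proof.
have /sigma_finiteP[F [TF ndF Foo]] := sigma_finiteT (@lebesgue_measure R).
exists (fun n => F n `*` F n).
  rewrite -setXTT TF predeqE => -[x y]; split.
    move=> [/= [n _ Fnx] [m _ Fmy]]; exists (maxn n m) => //; split.
      by move: x Fnx; exact/subsetPset/ndF/leq_maxl.
    by move: y Fmy; exact/subsetPset/ndF/leq_maxr.
  by move=> [n _ []/= ? ?]; split; exists n.
move=> n; have [? ?] := Foo n.
split; first exact: measurableX.
by rewrite /leb2 product_measure1E// lte_mul_pinfty// ge0_fin_numE.
Qed.
HB.instance Definition _ (R : realType) :=
  Measure_isSigmaFinite.Build _ _ _ (@leb2 R) (@leb2_sigma_finite R).

Definition leb3 (R : realType) :
    set (measurableTypeR R * measurableTypeR R * measurableTypeR R) -> \bar R :=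
  (@leb2 R \x @lebesgue_measure R)%E.
HB.instance Definition _ (R : realType) := Measure.on (@leb3 R).

(* A tetrahedron is given by its vertices [a : 'I_4 -> R3 R]. *)
Definition tetra (R : realType) (a : 'I_4 -> R3 R) : set (R3 R) :=
  [set x | exists c : 'I_4 -> R,
     [/\ forall i, 0 <= c i, \sum_i c i = 1 & x = \sum_i c i *: a i]].

Definition Ttilde (R : realType) (h : 'I_3 -> R) (i : 'I_4) : R3 R :=
  match val i with
  | 0 => 0
  | 1 => h 0 *: evec R 0 + h 1 *: evec R 1
  | 2 => h 1 *: evec R 1
  | _ => h 2 *: evec R 2
  end.

(* Face [i], opposite to vertex [i], parametrised affinely by [triangle]. *)
Definition triangle (R : realType) : set (R * R) :=
  [set s | [/\ 0 <= s.1, 0 <= s.2 & s.1 + s.2 <= 1]].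

Definition face_param (R : realType) (a : 'I_4 -> R3 R) (i : 'I_4)
    (s : R * R) : R3 R :=
  a (lift i 0) + s.1 *: (a (lift i 1) - a (lift i 0))
               + s.2 *: (a (lift i 2) - a (lift i 0)).

Definition face (R : realType) (a : 'I_4 -> R3 R) (i : 'I_4) : set (R3 R) :=
  face_param a i @` @triangle R.

Definition face_cross (R : realType) (a : 'I_4 -> R3 R) (i : 'I_4) : R3 R :=
  cross (a (lift i 1) - a (lift i 0)) (a (lift i 2) - a (lift i 0)).

Definition face_jac (R : realType) (a : 'I_4 -> R3 R) (i : 'I_4) : R :=
  enorm (fun j => xcoord j (face_cross a i)).

(* Its orientation depends on [i]; face moment conditions are insensitive to
   that. *)
Definition face_normal (R : realType) (a : 'I_4 -> R3 R) (i : 'I_4) : R3 R :=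
  (face_jac a i)^-1 *: face_cross a i.

Definition face_integral (R : realType) (a : 'I_4 -> R3 R) (i : 'I_4)
    (g : R3 R -> R) : \bar R :=
  ((face_jac a i)%:E *
   \int[@leb2 R]_(s in @triangle R) (g (face_param a i s))%:E)%E.

(* [is_poly n S f]: f is in P_(n-1)(S); as [msize] is 1 + the total degree, and
   0 for the zero polynomial, [n = 0] gives P_(-1) = {0}. On a face, the
   restrictions of polynomials in three variables of degree at most n - 1 are
   exactly the polynomials of degree at most n - 1 in two affine coordinates. *)
Definition is_poly (R : realType) (n : nat) (S : set (R3 R))
    (f : R3 R -> R) : Prop :=
  exists2 q : mpoly 3 R, (msize q <= n)%N &
    forall x, S x -> f x = meval (fun i => xcoord i x) q.

Definition is_RTspace (R : realType) (k : nat) (S : set (R3 R))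
    (v : 'I_3 -> R3 R -> R) : Prop :=
  exists (q : 'I_3 -> R3 R -> R) (r : R3 R -> R),
    [/\ forall i, is_poly k.+1 S (q i),
        is_poly k.+1 S r &
        forall i x, S x -> v i x = q i x + xcoord i x * r x].

Definition Lpnorm (R : realType) (S : set (R3 R)) (p : \bar R)
    (f : R3 R -> R) : \bar R :=
  'N[@leb3 R]_p[(EFin \o f) \_ S]%E.

Definition is_Lp (R : realType) (S : set (R3 R)) (p : \bar R)
    (f : R3 R -> R) : Prop :=
  measurable_fun S f /\ (Lpnorm S p f < +oo)%E.

(* C^infinity: all iterated partial derivatives are differentiable. *)
Definition smooth (R : realType) (f : R3 R -> R) : Prop :=
  forall (s : seq 'I_3) (x : R3 R),
    differentiable (foldr (fun j g => 'D_(evec R j) g) f s) x.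

Definition test_function (R : realType) (S : set (R3 R))
    (phi : R3 R -> R) : Prop :=
  let supp := closure [set x | phi x != 0] in
  [/\ smooth phi, compact supp & supp `<=` S°].

Definition is_weak_partial (R : realType) (S : set (R3 R)) (j : 'I_3)
    (f g : R3 R -> R) : Prop :=
  forall phi, test_function S phi ->
    \int[@leb3 R]_(x in S) (f x * 'D_(evec R j) phi x) =
    - \int[@leb3 R]_(x in S) (g x * phi x).

(* f is in W^{1,p} of the interior of S, with weak gradient Df. *)
Definition is_W1p (R : realType) (S : set (R3 R)) (p : \bar R)
    (f : R3 R -> R) (Df : 'I_3 -> R3 R -> R) : Prop :=
  is_Lp S p f /\ forall j, is_Lp S p (Df j) /\ is_weak_partial S j f (Df j).

(* g is the trace on face i of f, a W^{1,1} function with weak gradient Df: the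
   L^1(face) limit of the restrictions of smooth functions that converge to f
   in W^{1,1}. As tetrahedra have finite measure, this covers W^{1,p} for all
   p, including p = +oo, where smooth functions are not dense. *)
Definition is_trace (R : realType) (a : 'I_4 -> R3 R) (i : 'I_4)
    (f : R3 R -> R) (Df : 'I_3 -> R3 R -> R) (g : R3 R -> R) : Prop :=
  measurable_fun (@triangle R) (g \o face_param a i) /\
  exists phi : nat -> R3 R -> R,
    [/\ forall n, smooth (phi n),
        Lpnorm (tetra a) 1 (phi n \- f) @[n --> \oo] --> 0%E,
        forall j, Lpnorm (tetra a) 1 ('D_(evec R j) (phi n) \- Df j)
                    @[n --> \oo] --> 0%E &
        face_integral a i (fun x => `|phi n x - g x|) @[n --> \oo] --> 0%E].

(* v is the Raviart-Thomas interpolation of order k of u, a W^{1,1} field with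
   weak Jacobian Du. *)
Definition is_RTinterp (R : realType) (k : nat) (a : 'I_4 -> R3 R)
    (u : 'I_3 -> R3 R -> R) (Du : 'I_3 -> 'I_3 -> R3 R -> R)
    (v : 'I_3 -> R3 R -> R) : Prop :=
  [/\ is_RTspace k (tetra a) v,
      forall i : 'I_4, exists2 g : 'I_3 -> R3 R -> R,
        forall j, is_trace a i (u j) (Du j) (g j) &
        forall q, is_poly k.+1 (face a i) q ->
          face_integral a i
            (fun x => (\sum_j v j x * xcoord j (face_normal a i)) * q x) =
          face_integral a i
            (fun x => (\sum_j g j x * xcoord j (face_normal a i)) * q x) &
      forall q : 'I_3 -> R3 R -> R, (forall j, is_poly k (tetra a) (q j)) ->
        \int[@leb3 R]_(x in tetra a) (\sum_j v j x * q j x) =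
        \int[@leb3 R]_(x in tetra a) (\sum_j u j x * q j x)].

(* Main.v *)
Require Import Defs.
From HB Require Import structures.
From mathcomp Require Import all_boot all_order all_algebra.
From mathcomp Require Import -(notations) mpoly.
From mathcomp Require Import all_classical all_reals all_analysis.
From mathcomp Require Import measurable_realfun ess_sup_inf.
From mathcomp Require Import zify ring lra.
Set Implicit Arguments.
Unset Strict Implicit.
Unset Printing Implicit Defensive.
Import Order.TTheory GRing.Theory Num.Theory.
Import numFieldNormedType.Exports.
Local Open Scope classical_set_scope.
Local Open Scope ring_scope.

(* Take h = (1, H, 1), y = x2 / H, and let g be a nonzero form of degree k in
   (x1, y) with int_0^y g x1^a dx1 = 0 for all a < k; put G = int_0^x1 g dx1 and
   c = 2 k + 3. The field u = c (G, 0, - x3 g) is divergence-free, and an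
   integration slice by slice (x1 in [0, y] for fixed x2 and x3) shows that its
   interpolation is v = (dG/dy, - H g, 0). As H tends to infinity, the norm of v2
   grows like H |T|^(1/p), whereas the right-hand side stays bounded by a
   multiple of |T|^(1/p): the divergence vanishes, and the factor h2 = H is
   cancelled by the 1 / H in the derivative along x2. *)

(** * Measurability and the fundamental theorem of calculus *)

(** The field is built backwards from the face x2 / H + x3 = 1. Its normal is proportional to (0, 1,
    H), so a third component of size 1 contributes to the flux as much as a second component of size
    H. Since u2 = 0 and v3 = 0, the flux - c H x3 g must be carried by v2 alone: this is the origin
    of the factor H. Replacing c x3 g by g is legitimate only against test polynomials of degree at
    most k. By homogeneity every slice integral of g x1^a is a power of y times int_0^1 g(t, 1) t^a
    dt, so the orthogonality of g leaves a single test monomial: x1^k on this face, x1^(k - 1) for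
    the first component in the interior. Both comparisons give the same constant 2 k + 3. On the
    face x1 = y, Euler's identity y dG/dy + x1 g = (k + 1) G makes the flux of v a multiple of G,
    which vanishes there when k > 0; for k = 0 only mean values are tested, and c = 3 matches them.
    As [is_RTinterp] is a relation, it is enough to check that v satisfies it. *)

Lemma open_measurable3 (R : realType) (U : set (R3 R)) : open U -> measurable U.
Proof.
move=> oU.
pose box (a b c e : rat) : set (R3 R) :=
  (ball (ratr a : R) (ratr e) `*` ball (ratr b : R) (ratr e)) `*` ball (ratr c : R) (ratr e).
(* The product sigma-algebra contains boxes, so U is written as a countable union of rational ones;
   [set0] replaces the boxes that leave U. *)
have -> : U = \bigcup_a \bigcup_b \bigcup_c \bigcup_e
    (if `[< box a b c e `<=` U >] then box a b c e else set0).
  apply/seteqP; split => [x Ux|x].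
    have /nbhs_ballP[e /= e0 xeU] := open_nbhs_nbhs (conj oU Ux).
    have e20 : 0 < e / 2 by rewrite divr_gt0.
    have [q] := rat_in_itvoo e20; rewrite in_itv/= => /andP[q0 qe].
    have near (y : R) : exists r : rat, ball (ratr r : R) (ratr q) y.
      have : y - ratr q < y + ratr q by lra.
      move=> /rat_in_itvoo[r]; rewrite in_itv/= => /andP[r1 r2].
      by exists r; rewrite /ball/= ltr_distl; apply/andP; split; lra.
    have [[[a ax] [b bx]] [c cx]] := (near x.1.1, near x.1.2, near x.2).
    have near2 (r : rat) (y z : R) : ball (ratr r : R) (ratr q) y ->
        ball (ratr r : R) (ratr q) z -> ball y e z.
      rewrite /ball/= !ltr_distl => /andP[? ?] /andP[? ?].
      by apply/andP; split; lra.
    exists a => //; exists b => //; exists c => //; exists q => //.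
    case: asboolP => [_|]; first by [].
    case=> y [[ay b_y] cy]; apply: xeU; split; [split|].
    - exact: near2 ax ay.
    - exact: near2 bx b_y.
    - exact: near2 cx cy.
  move=> [a _ [b _ [c _ [e _]]]]; case: asboolP => // + bx; exact.
do 4 (apply: bigcupT_measurable_rat => ?).
case: asboolP => // _; apply: measurableX; [apply: measurableX|];
  by rewrite ball_itv; exact: measurable_itv.
Qed.

Lemma continuous_measurable_fun3 (R : realType) (f : R3 R -> R) :
  continuous f -> measurable_fun setT f.
Proof.
move=> /continuousP cf.
apply: (measurability _ (RGenOpens.measurableE R)) => _ [_ [a [b ->] <-]].
rewrite setTI; apply: open_measurable3; apply: cf; exact: interval_open.
Qed.

Lemma integral_derive (R : realType) (F f : R -> R) (a b : R) : a <= b ->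
  (forall x : R, is_derive x 1 F (f x)) -> continuous f ->
  (\int[lebesgue_measure]_(x in `[a, b]) (f x)%:E = (F b - F a)%:E)%E.
Proof.
rewrite le_eqVlt => /predU1P[<- _ _|ab dF cf].
  by rewrite set_itv1 integral_set1 subrr.
have cF : continuous F.
  by move=> x; apply/differentiable_continuous/derivable1_diffP.
rewrite EFinB (continuous_FTC2 (F := F)) //.
- exact: continuous_subspaceT.
- split => [x _||]; [by []|..]; apply: cvg_within_filter; exact: cF.
- by move=> x _; rewrite derive1E derive_val.
Qed.

Lemma is_derive_affine_pow (R : realType) (C p q : R) (n : nat) (x : R) :
  is_derive x 1 (fun x => C * (p + q * x) ^+ n)
    (C * (n%:R * (p + q * x) ^+ n.-1 * q)).
Proof.
have -> : (fun x => C * (p + q * x) ^+ n) =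
    cst C * (cst p + cst q * id) ^+ n :> (R -> R).
  by apply/funext => y; rewrite !fctE.
apply: is_derive_eq; rewrite !fctE /GRing.scale/=; ring.
Qed.

Lemma continuous_affine_pow (R : realType) (C p q : R) (n : nat) :
  continuous (fun x : R => C * (p + q * x) ^+ n).
Proof.
move=> x; apply/differentiable_continuous/derivable1_diffP.
by have [] := is_derive_affine_pow C p q n x.
Qed.

(** * Integrals with known values *)

(** Integrability and value travel together, so that sums and multiples of known integrals follow
    without side conditions, for extended-real and for real integrals alike. *)
Definition has_integral d (T : measurableType d) (R : realType)
    (mu : {measure set T -> \bar R}) (D : set T) (f : T -> R) (r : R) : Prop :=
  mu.-integrable D (EFin \o f) /\ (\int[mu]_(x in D) (f x)%:E = r%:E)%E.

Section has_integral.
Context d (T : measurableType d) (R : realType) (mu : {measure set T -> \bar R}).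
Variables (D : set T) (mD : measurable D).

(** For a nonnegative function a finite integral already is integrability; Tonelli's theorem can
    thus provide both parts at once. *)
Lemma has_integral_ge0 (f : T -> R) r : measurable_fun D f -> (forall x, D x -> 0 <= f x) ->
  (\int[mu]_(x in D) (f x)%:E = r%:E)%E -> has_integral mu D f r.
Proof.
move=> mf f0 fr; split => //; apply/integrableP; split.
  exact/measurable_EFinP.
under eq_integral => x xD.
  rewrite gee0_abs; last by rewrite lee_fin f0//; exact: set_mem.
  over.
by rewrite /= fr ltry.
Qed.

Lemma eq_has_integral (f g : T -> R) r : {in D, f =1 g} ->
  has_integral mu D f r -> has_integral mu D g r.
Proof.
move=> fg [fi fr]; split.
  by apply: eq_integrable fi => // x xD /=; rewrite fg.
by rewrite -fr; apply: eq_integral => x xD; rewrite fg.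
Qed.

Lemma has_integral0 : has_integral mu D (cst 0) 0.
Proof. by split; [exact: integrable0|exact: integral0]. Qed.

Lemma has_integralD f g r s : has_integral mu D f r -> has_integral mu D g s ->
  has_integral mu D (f \+ g) (r + s).
Proof.
move=> [fi fr] [gi gs]; split.
  by apply: eq_integrable (integrableD mD fi gi).
by rewrite EFinD -fr -gs -integralD_EFin.
Qed.

Lemma has_integralZ c f r : has_integral mu D f r ->
  has_integral mu D (fun x => c * f x) (c * r).
Proof.
move=> [fi fr]; split.
  by have := integrableZl mD c fi; apply: eq_integrable => // x _ /=; rewrite EFinM.
by rewrite EFinM -fr -integralZl//.
Qed.

Lemma has_integral_sum (I : eqType) (s : seq I) (f : I -> T -> R) (r : I -> R) :
  (forall i, i \in s -> has_integral mu D (f i) (r i)) ->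
  has_integral mu D (fun x => \sum_(i <- s) f i x) (\sum_(i <- s) r i).
Proof.
elim: s => [_|i s ih fr].
  rewrite big_nil; apply: eq_has_integral has_integral0 => x _.
  by rewrite big_nil.
rewrite big_cons; apply: (@eq_has_integral (f i \+ fun x => \sum_(i <- s) f i x)).
  by move=> x _; rewrite big_cons.
apply: has_integralD; first by apply: fr; rewrite mem_head.
by apply: ih => j js; apply: fr; rewrite inE js orbT.
Qed.

Lemma has_integral_Rintegral f r : has_integral mu D f r ->
  \int[mu]_(x in D) f x = r.
Proof. by move=> [_ fr]; rewrite /Rintegral fr. Qed.

End has_integral.

(** * Iterated integrals in two and three variables *)

Section tonelli.
Variable R : realType.
Local Notation leb := (@lebesgue_measure R).
Local Open Scope ereal_scope.

Lemma tonelli2 (f : R * R -> \bar R) : measurable_fun setT f ->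
  (forall x, 0 <= f x) ->
  \int[@leb2 R]_x f x = \int[leb]_y \int[leb]_x f (x, y).
Proof. by move=> mf f0; exact: fubini_tonelli2. Qed.

Lemma tonelli3 (f : R3 R -> \bar R) : measurable_fun setT f ->
  (forall x, 0 <= f x) ->
  \int[@leb3 R]_x f x = \int[leb]_z \int[leb]_y \int[leb]_x f (x, y, z).
Proof.
move=> mf f0.
transitivity (\int[leb]_z \int[@leb2 R]_x f (x, z)).
  exact: (@fubini_tonelli2 _ _ _ _ R (@leb2 R) leb).
apply: eq_integral => z _; rewrite tonelli2//.
apply: (measurableT_comp mf); exact: measurable_fun_pair.
Qed.

End tonelli.

(** * Moments over the tetrahedron and over the reference triangle *)

Section moments.
Variable R : realType.
Local Notation leb := (@lebesgue_measure R).

(** The affine base covers all the integrands met below: [x], [x / H], [1 - x] and [1 - y - x]. *)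
Lemma integral_affine_pow (C p q b : R) (n : nat) : 0 <= b -> q != 0 ->
  (\int[leb]_(x in `[0%R, b]) (C * (p + q * x) ^+ n)%:E =
   (C * ((p + q * b) ^+ n.+1 - p ^+ n.+1) / (q * n.+1%:R))%:E)%E.
Proof.
move=> b0 q0.
have n0 : n.+1%:R != 0 :> R by rewrite pnatr_eq0.
pose F (x : R) := C / (q * n.+1%:R) * (p + q * x) ^+ n.+1.
transitivity ((F b - F 0)%:E); last first.
  congr EFin; rewrite /F mulr0 addr0; move: n0.
  by generalize (n.+1%:R : R) => N N0; field; rewrite q0 N0.
apply: integral_derive => //; last exact: continuous_affine_pow.
move=> x; apply: (is_derive_eq (is_derive_affine_pow _ p q n.+1 x)); move: n0; generalize (n.+1%:R : R) => N N0 /=.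
by field; rewrite q0 N0.
Qed.

(** The Beta value B(m + 1, c + 1). It stays symbolic: the moments that are not annihilated by the
    choice of g only involve c = 0 and c = 1. *)
Definition beta_int (m c : nat) : R :=
  \int[leb]_(s in `[0, 1]) ((1 - s) ^+ m * s ^+ c).

Lemma has_integral_beta m c :
  has_integral leb `[0, 1] (fun s => (1 - s) ^+ m * s ^+ c) (beta_int m c).
Proof.
have ib : leb.-integrable `[0, 1] (EFin \o fun s : R => (1 - s) ^+ m * s ^+ c).
  apply: continuous_compact_integrable; first exact: segment_compact.
  apply: continuous_subspaceT => x.
  have -> : (fun s : R => (1 - s) ^+ m * s ^+ c) =
      (fun s : R => 1 * (1 + (-1) * s) ^+ m) \* (fun s : R => 1 * (0 + 1 * s) ^+ c).
    by apply/funext => s /=; rewrite add0r !mul1r mulN1r.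
  apply: continuousM; exact: continuous_affine_pow.
split => //; rewrite /beta_int /Rintegral fineK//.
by apply: integral_fune_fin_num.
Qed.

Lemma beta_int0 m : beta_int m 0 = m.+1%:R^-1.
Proof.
rewrite /beta_int /Rintegral.
transitivity (fine (\int[leb]_(s in `[0%R, 1%R]) (1 * (1 + (-1) * s) ^+ m)%:E)).
  by congr fine; apply: eq_integral => s _; rewrite expr0 mulN1r mul1r mulr1.
rewrite integral_affine_pow ?oppr_eq0 ?oner_eq0 ?ler01//=.
by rewrite mulr1 subrr expr0n expr1n/= sub0r mul1r !mulN1r invrN opprK.
Qed.

(** Writing s = 1 - (1 - s) reduces this to a difference of two values of [beta_int0]. *)
Lemma beta_int1 m : beta_int m 1 = (m.+1%:R * m.+2%:R)^-1.
Proof.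
have m01 : measurable (`[0, 1]%classic : set (measurableTypeR R)).
  exact: measurable_itv.
have := has_integralD m01 (has_integral_beta m 0)
  (has_integralZ m01 (-1) (has_integral_beta m.+1 0)).
move/(@eq_has_integral _ _ _ _ _ m01 _ (fun s : R => (1 - s) ^+ m * s ^+ 1)).
case=> [s _|_ +] /=; first by rewrite !expr0 exprS; ring.
have [_ ->] := has_integral_beta m 1 => -[->].
rewrite !beta_int0 -[m.+2%:R]natr1.
have : m.+1%:R + 1 != 0 :> R by rewrite natr1 pnatr_eq0.
have : m.+1%:R != 0 :> R by rewrite pnatr_eq0.
generalize (m.+1%:R : R) => N ? ?; field.
by apply/andP; split.
Qed.

End moments.

(** Monomials in the rescaled coordinates x1, x2 / H, x3, in which the tetrahedron does not depend
    on H. *)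
Definition mon (R : realType) (H : R) (m : nat * nat * nat) (x : R3 R) : R :=
  x.1.1 ^+ m.1.1 * (x.1.2 / H) ^+ m.1.2 * x.2 ^+ m.2.

(** The tetrahedron of sides (1, H, 1) given by its four faces ([tetra_slab]), in a form that shows
    the slice 0 <= x1 <= x2 / H used for integration. *)
Definition slab (R : realType) (H : R) : set (R3 R) :=
  [set x | [/\ 0 <= x.1.1, x.1.1 <= x.1.2 / H, 0 <= x.2 & x.1.2 / H + x.2 <= 1]].

Section moments3.
Variable R : realType.
Local Notation leb := (@lebesgue_measure R).

Lemma measurable_coord1 : measurable_fun setT (fun x : R3 R => x.1.1).
Proof. exact: measurableT_comp. Qed.

Lemma measurable_coord2 : measurable_fun setT (fun x : R3 R => x.1.2).
Proof. exact: measurableT_comp. Qed.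

Lemma measurable_coord3 : measurable_fun setT (fun x : R3 R => x.2).
Proof. exact: measurable_snd. Qed.

Lemma measurable_mon (H : R) m : measurable_fun setT (mon H m).
Proof.
apply: measurable_funM; [apply: measurable_funM|]; apply: measurable_funX.
- exact: measurable_coord1.
- by apply: measurable_funM => //; exact: measurable_coord2.
- exact: measurable_coord3.
Qed.

Lemma measurable_slab (H : R) : measurable (slab H).
Proof.
have -> : slab H = ([set x | 0 <= x.1.1] `&` [set x | x.1.1 <= x.1.2 / H]) `&`
   ([set x | 0 <= x.2] `&` [set x | x.1.2 / H + x.2 <= 1]).
  by apply/seteqP; split => [x []|x [[? ?] []]].
have m1 := measurable_coord1; have m2 := measurable_coord2.
have m3 := measurable_coord3.
have m2H : measurable_fun setT (fun x : R3 R => x.1.2 / H).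
  exact: measurable_funM.
have m23 : measurable_fun setT (fun x : R3 R => x.1.2 / H + x.2).
  exact: measurable_funD.
have mle (f g : R3 R -> R) : measurable_fun setT f -> measurable_fun setT g ->
    measurable [set x | f x <= g x].
  by move=> mf mg; rewrite -[X in measurable X]setTI; exact: measurable_fun_le.
by apply: measurableI; apply: measurableI; apply: mle.
Qed.

(** The inner variable is x1, over [0, y / H]. The exponents a and b merge into their sum, and a
    alone survives only in the factor 1 / (a + 1): this is what turns moments of g into moments in
    x1. *)
Lemma integral_mon_slab1 (H y z : R) (a b c : nat) : 0 < H ->
  (\int[leb]_x ((mon H (a, b, c) \_ (slab H)) (x, y, z))%:E =
   (if [&& 0 <= z, 0 <= y & y / H + z <= 1] then
     (y / H) ^+ (a + b).+1 * z ^+ c / a.+1%:R else 0)%:E)%E.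
Proof.
move=> H0.
have yH (s : R) : 0 <= s -> s <= y / H -> 0 <= y.
  move=> s0 sy; have := le_trans s0 sy.
  by rewrite pmulr_lge0// invr_gt0.
case: ifPn => [/and3P[z0 y0 yz]|nyz]; last first.
  rewrite integral0_eq// => x _; rewrite patchE ifF//.
  apply/negbTE; move: nyz; apply: contra; rewrite inE/= => -[/= x0 xy z0 yz].
  by rewrite z0 yz (yH x).
transitivity (\int[leb]_(x in `[0%R, (y / H)%R])
    ((y / H) ^+ b * z ^+ c * (0 + 1 * x) ^+ a)%:E)%E.
  rewrite [RHS]integral_mkcond; apply: eq_integral => x _.
  rewrite patchE [RHS]patchE.
  have -> : ((x, y, z) \in slab H) = (x \in [set` `[0, y / H]]).
    apply/idP/idP; rewrite !inE/= in_itv/=.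
      by case=> /= -> ->.
    by move=> /andP[].
  by case: ifP => // _; congr EFin; rewrite /mon/= add0r mul1r; ring.
rewrite integral_affine_pow ?oner_eq0 ?divr_ge0 ?(ltW H0)//.
congr EFin; rewrite mul1r add0r expr0n subr0 mul1r. rewrite addnC -addnS exprD. ring.
Qed.

(** At height z the variable x2 runs over [0, H (1 - z)]; its rescaling produces the only factor
    H. *)
Lemma integral_mon_slab2 (H z : R) (a b c : nat) : 0 < H ->
  (\int[leb]_y \int[leb]_x ((mon H (a, b, c) \_ (slab H)) (x, y, z))%:E =
   (((fun s => H / (a.+1%:R * (a + b).+2%:R) * ((1 - s) ^+ (a + b).+2 * s ^+ c))
     \_ `[0, 1]) z)%:E)%E.
Proof.
move=> H0.
under eq_integral do rewrite integral_mon_slab1//.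
rewrite patchE; case: ifPn => [|nz]; last first.
  rewrite integral0_eq// => y _; rewrite ifF//.
  apply/negbTE; move: nz; apply: contra; rewrite inE/= in_itv/= => /and3P[-> y0 yz] /=.
  by apply: le_trans yz; rewrite lerDr divr_ge0// ltW.
rewrite inE/= in_itv/= => /andP[z0 z1].
transitivity (\int[leb]_(x in `[0%R, (H * (1 - z))%R])
    (z ^+ c / a.+1%:R * (0 + H^-1 * x) ^+ (a + b).+1)%:E)%E.
  rewrite [RHS]integral_mkcond; apply: eq_integral => y _.
  rewrite patchE z0 /=.
  have -> : (y \in [set` `[0, H * (1 - z)]]) = (0 <= y) && (y / H + z <= 1).
    by rewrite mem_setE in_itv/= -lerBrDr ler_pdivrMr// [_ * H]mulrC.
  case: ifP => _; last by [].
  by congr EFin; rewrite add0r [H^-1 * y]mulrC -mulrA; exact: mulrC.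
rewrite integral_affine_pow ?invr_eq0 ?gt_eqF ?mulr_ge0 ?subr_ge0 ?(ltW H0)//.
congr EFin; rewrite add0r mulKf ?gt_eqF// expr0n subr0.
field.
rewrite -!natrD ?nat1r !pnatr_eq0.
by rewrite addSn /= lt0r_neq0.
Qed.

Lemma has_integral_mon (H : R) (a b c : nat) : 0 < H ->
  has_integral (@leb3 R) (slab H) (mon H (a, b, c))
    (H / (a.+1%:R * (a + b).+2%:R) * beta_int R (a + b).+2 c).
Proof.
move=> H0; apply: has_integral_ge0.
- by apply: measurable_funTS; exact: measurable_mon.
- move=> x [/= x0 xy z0 yz]; rewrite /mon/= !mulr_ge0 ?exprn_ge0//.
  exact: le_trans xy.
have mfs : measurable_fun setT (mon H (a, b, c) \_ (slab H)).
  apply/(measurable_restrictT _ (measurable_slab H)).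
  by apply: measurable_funTS; exact: measurable_mon.
rewrite integral_mkcond restrict_EFin.
rewrite tonelli3.
- under eq_integral do rewrite integral_mon_slab2//.
  have m01 : measurable (`[0, 1]%classic : set (measurableTypeR R)).
    exact: measurable_itv.
  have [_ <-] := has_integralZ m01 (H / (a.+1%:R * (a + b).+2%:R))
    (has_integral_beta R (a + b).+2 c).
  by rewrite [RHS]integral_mkcond restrict_EFin.
- exact/measurable_EFinP.
- move=> x; rewrite lee_fin patchE; case: ifPn => // /set_mem[/= x0 xy z0 yz].
  by rewrite /mon/= !mulr_ge0 ?exprn_ge0//; exact: le_trans xy.
Qed.

End moments3.

Section triangle_moments.
Variable R : realType.
Local Notation leb := (@lebesgue_measure R).

Lemma measurable_triangle : measurable (@triangle R).
Proof.
have -> : @triangle R = [set s | 0 <= s.1] `&` ([set s | 0 <= s.2] `&`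
    [set s | s.1 + s.2 <= 1]).
  by apply/seteqP; split => [x []|x [? []]].
have mle (f g : R * R -> R) : measurable_fun setT f -> measurable_fun setT g ->
    measurable [set x | f x <= g x].
  by move=> mf mg; rewrite -[X in measurable X]setTI; exact: measurable_fun_le.
apply: measurableI; [|apply: measurableI]; apply: mle => //.
exact: measurable_funD.
Qed.

(** The three bases are x1, x2 / H and x3 on the face opposite to the origin, see [face_param0]. *)
Definition tmon (a b c : nat) (s : R * R) : R :=
  (1 - s.1 - s.2) ^+ a * (1 - s.2) ^+ b * s.2 ^+ c.

Lemma measurable_tmon a b c : measurable_fun setT (tmon a b c).
Proof.
by apply: measurable_funM; [apply: measurable_funM|]; apply: measurable_funX => //;
  repeat apply: measurable_funB.
Qed.

Lemma tmon_ge0 a b c s : triangle s -> 0 <= tmon a b c s.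
Proof.
move=> [s1 s2 s12]; rewrite /tmon !mulr_ge0 ?exprn_ge0//; lra.
Qed.

Lemma integral_tmon1 (y : R) (a b c : nat) :
  (\int[leb]_x ((tmon a b c \_ (@triangle R)) (x, y))%:E =
   (((fun s : R => a.+1%:R^-1 * ((1 - s) ^+ (a + b).+1 * s ^+ c))
     \_ `[0, 1]) y)%:E)%E.
Proof.
rewrite patchE; case: ifPn => [|ny]; last first.
  rewrite integral0_eq// => x _; rewrite patchE ifF//.
  apply/negbTE; move: ny; apply: contra; rewrite !inE/= in_itv/= => -[/= ? ? ?].
  by apply/andP; split => //; lra.
rewrite inE/= in_itv/= => /andP[y0 y1].
transitivity (\int[leb]_(x in `[0%R, (1 - y)%R])
    ((1 - y) ^+ b * y ^+ c * ((1 - y) + (-1) * x) ^+ a)%:E)%E.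
  rewrite [RHS]integral_mkcond; apply: eq_integral => x _.
  rewrite !patchE.
  have -> : ((x, y) \in @triangle R) = (x \in [set` `[0, 1 - y]]).
    rewrite mem_setE in_itv/= lerBrDr; apply/idP/idP; rewrite !inE/=.
      by case=> /= -> _ ->.
    by move=> /andP[].
  case: ifP => // _; congr EFin; rewrite /tmon/= mulN1r [1 - x - y]addrAC; ring.
rewrite integral_affine_pow ?oppr_eq0 ?oner_eq0 ?subr_ge0//.
congr EFin; rewrite mulN1r subrr expr0n/= -addSn exprD; field.
by rewrite nat1r pnatr_eq0.
Qed.

Lemma has_integral_tmon (a b c : nat) :
  has_integral (@leb2 R) (@triangle R) (tmon a b c)
    (a.+1%:R^-1 * beta_int R (a + b).+1 c).
Proof.
have mfs : measurable_fun setT (tmon a b c \_ (@triangle R)).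
  apply/(measurable_restrictT _ measurable_triangle).
  by apply: measurable_funTS; exact: measurable_tmon.
apply: has_integral_ge0.
- by apply: measurable_funTS; exact: measurable_tmon.
- by move=> x; exact: tmon_ge0.
rewrite integral_mkcond restrict_EFin.
rewrite tonelli2.
- under eq_integral do rewrite integral_tmon1//.
  have m01 : measurable (`[0, 1]%classic : set (measurableTypeR R)).
    exact: measurable_itv.
  have [_ <-] := has_integralZ m01 (a.+1%:R^-1)
    (has_integral_beta R (a + b).+1 c).
  by rewrite [RHS]integral_mkcond restrict_EFin.
- exact/measurable_EFinP.
- by move=> x; rewrite lee_fin patchE; case: ifPn => // /set_mem /tmon_ge0.
Qed.

End triangle_moments.

(** * Polynomials as lists of monomials *)

Section monomials.
Variable R : realType.
Implicit Types (H : R) (m : nat * nat * nat) (s : seq (R * (nat * nat * nat))).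

Definition mexp (j : 'I_3) m : nat :=
  match val j with 0 => m.1.1 | 1 => m.1.2 | _ => m.2 end.

(** At exponent 0 the truncated predecessor changes nothing; this is harmless, as the coefficient
    [mexp] is then 0. *)
Definition mdec (j : 'I_3) m : nat * nat * nat :=
  match val j with
  | 0 => (m.1.1.-1, m.1.2, m.2)
  | 1 => (m.1.1, m.1.2.-1, m.2)
  | _ => (m.1.1, m.1.2, m.2.-1)
  end.

Definition mtot m : nat := (m.1.1 + m.1.2 + m.2)%N.

Definition sides H (j : 'I_3) : R := if val j == 1%N then H else 1.

Lemma xcoord_is_linear (i : 'I_3) :
  exists2 f : {linear R3 R -> R}, xcoord i = f & continuous f.
Proof.
case: i => -[|[|[|//]]] i3.
- exists (fst \o fst : {linear R3 R -> R}) => //.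
  by move=> y; apply: cvg_comp; [exact: cvg_fst|exact: cvg_fst].
- exists (snd \o fst : {linear R3 R -> R}) => //.
  by move=> y; apply: cvg_comp; [exact: cvg_fst|exact: cvg_snd].
- by exists (snd : {linear R3 R -> R}) => // y; exact: cvg_snd.
Qed.

Lemma differentiable_xcoord (x : R3 R) (i : 'I_3) : differentiable (xcoord i) x.
Proof.
by have [f -> cf] := xcoord_is_linear i; exact: linear_differentiable.
Qed.

Lemma is_derive_xcoord (x v : R3 R) (i : 'I_3) :
  is_derive x v (xcoord i) (xcoord i v).
Proof.
have [f -> cf] := xcoord_is_linear i.
apply: DeriveDef; first exact/diff_derivable/linear_differentiable.
by rewrite deriveE ?diff_lin//; exact: linear_differentiable.
Qed.

(** Ring operations on functions are the form on which the differentiation rules act. *)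
Lemma monE H m : mon H m = (xcoord 0 ^+ m.1.1) *
  (xcoord 1 * cst H^-1) ^+ m.1.2 * (xcoord 2 ^+ m.2) :> (R3 R -> R).
Proof. by apply/funext => x; rewrite /mon !fctE. Qed.

Lemma differentiable_expr (f : R3 R -> R) n x :
  differentiable f x -> differentiable (f ^+ n) x.
Proof. by case: n => [_|n]; [rewrite expr0|exact: differentiableX]. Qed.

Lemma differentiable_mon H m x : differentiable (mon H m) x.
Proof.
rewrite monE; apply: differentiableM; [apply: differentiableM|].
- apply: differentiable_expr; exact: differentiable_xcoord.
- by apply: differentiable_expr; apply: differentiableM => //; exact: differentiable_xcoord.
- apply: differentiable_expr; exact: differentiable_xcoord.
Qed.

Lemma is_derive_mon H m (j : 'I_3) (x : R3 R) :
  is_derive x (evec R j) (mon H m)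
    ((sides H j)^-1 * ((mexp j m)%:R * mon H (mdec j m) x)).
Proof.
have h0 := is_derive_xcoord x (evec R j) 0.
have h1 := is_derive_xcoord x (evec R j) 1.
have h2 := is_derive_xcoord x (evec R j) 2.
rewrite [mon H m]monE.
apply: is_derive_eq.
rewrite !fctE /GRing.scale/=.
move: j {h0 h1 h2} => [[|[|[|//]]] j3]; rewrite /sides /mon /mexp /mdec /xcoord/= ?invr1;
  move: (m.1.1.-1) (m.1.2.-1) (m.2.-1) => a b c; ring.
Qed.

(* The coefficients of [lc H s] in x1, x2 / H and x3 do not depend on [H]; this
   makes the bounds below uniform in [H]. *)
Definition lc H s (x : R3 R) : R := \sum_(t <- s) t.1 * mon H t.2 x.

Definition scale_lc (c : R) s := [seq (c * t.1, t.2) | t <- s].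

(** Derivative with respect to the rescaled coordinates. The chain-rule factor [(sides H j)^-1]
    stays outside, where the weight h_j of the estimate cancels it. *)
Definition dlc (j : 'I_3) s :=
  [seq (t.1 * (mexp j t.2)%:R, mdec j t.2) | t <- s].

Lemma lc_nil H : lc H [::] = cst 0.
Proof. by apply/funext => x; rewrite /lc big_nil. Qed.

Lemma lc_cons H t s : lc H (t :: s) = cst t.1 * mon H t.2 + lc H s.
Proof. by apply/funext => x; rewrite /lc big_cons. Qed.

Lemma lc_scale H c s x : lc H (scale_lc c s) x = c * lc H s x.
Proof.
by rewrite /lc big_map mulr_sumr; apply: eq_bigr => t _; rewrite mulrA.
Qed.

Lemma measurable_lc H s : measurable_fun setT (lc H s).
Proof.
elim: s => [|t s ih]; first by rewrite lc_nil; exact: measurable_cst.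
rewrite lc_cons; apply: measurable_funD ih.
by apply: measurable_funM; [exact: measurable_cst|exact: measurable_mon].
Qed.

Lemma differentiable_lc H s x : differentiable (lc H s) x.
Proof.
elim: s => [|t s ih]; first by rewrite lc_nil.
rewrite lc_cons; apply: differentiableD ih.
by apply: differentiableM => //; exact: differentiable_mon.
Qed.

Lemma is_derive_lc H s (j : 'I_3) (x : R3 R) :
  is_derive x (evec R j) (lc H s) ((sides H j)^-1 * lc H (dlc j s) x).
Proof.
elim: s => [|t s ih].
  by rewrite /= !lc_nil mulr0; exact: is_derive_cst.
have ht := is_derive_mon H t.2 j x.
rewrite lc_cons /= lc_cons; apply: is_derive_eq.
by rewrite /GRing.scale/= mulr0 addr0 !fctE; ring.
Qed.

Lemma derive_lc H s (j : 'I_3) :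
  'D_(evec R j) (lc H s) = lc H (scale_lc (sides H j)^-1 (dlc j s)).
Proof.
apply/funext => x; rewrite lc_scale.
by have := is_derive_lc H s j x => ?; rewrite derive_val.
Qed.

(** Functions of the form [lc H s] are stable under partial derivatives, so an induction on the list
    of directions suffices. *)
Lemma smooth_lc H s : smooth (lc H s).
Proof.
move=> l x; have [s' ->] : exists s', foldr (fun j g => 'D_(evec R j) g) (lc H s) l
    = lc H s'.
  elim: l => [|j l [s' /= ->]]; first by exists s.
  by eexists; exact: derive_lc.
exact: differentiable_lc.
Qed.

Lemma mon_le1 H m x : slab H x -> `|mon H m x| <= 1.
Proof.
move=> [x0 xy z0 yz]; have y0 := le_trans x0 xy.
have p1 (t : R) n : 0 <= t -> t <= 1 -> `|t ^+ n| <= 1.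
  by move=> t0 t1; rewrite normrX ger0_norm// exprn_ile1.
rewrite /mon !normrM; apply: mulr_ile1 => //; [apply: mulr_ile1 => //|];
  apply: p1 => //; lra.
Qed.

Lemma lc_bound H s x : slab H x -> `|lc H s x| <= \sum_(t <- s) `|t.1|.
Proof.
move=> sx; apply: le_trans (ler_norm_sum _ _ _) _; apply: ler_sum => t _.
by rewrite normrM ler_piMr// mon_le1.
Qed.

End monomials.

Section polynomials.
Variable R : realType.
Implicit Types (H : R) (s : seq (R * (nat * nat * nat))) (S : set (R3 R)).

Definition mnm3 (m : nat * nat * nat) : multinom 3 :=
  Multinom [tuple m.1.1; m.1.2; m.2].

Lemma prod3 (f : 'I_3 -> R) : \prod_i f i = f 0 * f 1 * f 2%:R.
Proof.
rewrite !big_ord_recl big_ord0 mulr1 mulrA.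
by congr (f _ * f _ * f _); exact/val_inj.
Qed.

Lemma is_poly_lc H n S s : all (fun t => mtot t.2 < n)%N s -> is_poly n S (lc H s).
Proof.
move=> /allP sn.
exists (\sum_(t <- s) ((t.1 * H^-1 ^+ t.2.1.2) *: mpolyX R (mnm3 t.2))).
  apply: (leq_trans (msize_sum _ _ _)); apply/bigmax_leqP_seq => t ts _.
  apply: (leq_trans (msizeZ_le _ _)); rewrite msizeX.
  apply: leq_trans (sn _ ts); rewrite ltnS mdegE.
  by rewrite !big_ord_recl big_ord0 /mtot !multinomE addn0 addnA.
move=> x _; rewrite raddf_sum; apply: eq_bigr => t _; rewrite /=.
rewrite mevalZ mevalX prod3 !multinomE /= /mon /xcoord /= exprMn; ring.
Qed.

(** Passing from powers of x2 to powers of x2 / H only multiplies coefficients by powers of H, so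
    degrees are kept; test polynomials can then be treated monomial by monomial. *)
Lemma lc_is_poly H n S (q : R3 R -> R) : H != 0 -> is_poly n S q ->
  exists2 s, all (fun t => mtot t.2 < n)%N s & forall x, S x -> q x = lc H s x.
Proof.
move=> H0 [p pn qp].
exists [seq (mcoeff m p * H ^+ m 1, (m 0, m 1, m 2%:R)) | m <- msupp p].
  rewrite all_map; apply/allP => m mp /=.
  apply: leq_trans pn; apply: leq_ltn_trans (msize_mdeg_lt mp).
  rewrite mdegE !big_ord_recl big_ord0 addn0 addnA /mtot/=.
  by apply: eq_leq; congr (m _ + m _ + m _)%N; exact/val_inj.
move=> x Sx; rewrite qp// mevalE /lc [RHS]big_map; apply: eq_bigr => m _.
rewrite prod3 /mon/= /xcoord/= expr_div_n; field.
by rewrite expf_neq0.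
Qed.

End polynomials.

(** * The Raviart-Thomas interpolation of the field u *)

Section counterexample.
Variables (R : realType) (k : nat) (g : nat -> R).

(** This is int_0^1 g(t, 1) t^a dt, a row of a Hilbert matrix applied to the coefficients; int_0^y g
    x1^a dx1 is y^(k + a + 1) times it. *)
Definition hilbert_moment (a : nat) : R := \sum_(i < k.+1) g i / (i + a).+1%:R.

Local Notation M := hilbert_moment.
Local Notation K := (@beta_int R).

(* With y = x2 / H and g = sum_i g_i x1^i y^(k - i), whose primitive in x1 is G,
   these lists represent c g, c G, c x3 g and dG/dy. In the last one the index
   [i = k] is left out, as its coefficient is zero. *)
Definition gseq (c : R) : seq (R * (nat * nat * nat)) :=
  [seq (c * g i, (i, k - i, 0)%N) | i <- index_iota 0 k.+1].

Definition Gseq (c : R) : seq (R * (nat * nat * nat)) :=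
  [seq (c * g i / i.+1%:R, (i.+1, k - i, 0)%N) | i <- index_iota 0 k.+1].

Definition zgseq (c : R) : seq (R * (nat * nat * nat)) :=
  [seq (c * g i, (i, k - i, 1)%N) | i <- index_iota 0 k.+1].

Definition dGseq : seq (R * (nat * nat * nat)) :=
  [seq (g i * (k - i)%:R / i.+1%:R, (i.+1, k - i.+1, 0)%N) | i <- index_iota 0 k].

Definition slab_moment (H : R) (m : nat * nat * nat) : R :=
  H / (m.1.1.+1%:R * (m.1.1 + m.1.2).+2%:R) * K (m.1.1 + m.1.2).+2 m.2.

Definition tri_moment (m : nat * nat * nat) : R :=
  m.1.1.+1%:R^-1 * K (m.1.1 + m.1.2).+1 m.2.

Definition madd (m n : nat * nat * nat) : nat * nat * nat :=
  (m.1.1 + n.1.1, m.1.2 + n.1.2, m.2 + n.2)%N.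

(** All terms of g times a monomial have the same total exponent in x1 and y, so everything factors
    out of the sum except 1 / (i + a + 1). *)
Lemma gseq_slab_moment H c m :
  \sum_(t <- gseq c) t.1 * slab_moment H (madd t.2 m) =
  c * H / (k + m.1.1 + m.1.2).+2%:R * K (k + m.1.1 + m.1.2).+2 m.2 * M m.1.1.
Proof.
rewrite big_map big_mkord mulr_sumr; apply: eq_bigr => i _ /=.
rewrite /slab_moment /madd/=.
have -> : (i + m.1.1 + (k - i + m.1.2) = k + m.1.1 + m.1.2)%N.
  by rewrite addnACA subnKC ?addnA// -ltnS.
rewrite add0n; field.
by rewrite -!natrD ?nat1r !pnatr_eq0 ?addSn.
Qed.

Lemma zgseq_slab_moment H c m :
  \sum_(t <- zgseq c) t.1 * slab_moment H (madd t.2 m) =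
  c * H / (k + m.1.1 + m.1.2).+2%:R * K (k + m.1.1 + m.1.2).+2 m.2.+1 * M m.1.1.
Proof.
rewrite big_map big_mkord mulr_sumr; apply: eq_bigr => i _ /=.
rewrite /slab_moment /madd/=.
have -> : (i + m.1.1 + (k - i + m.1.2) = k + m.1.1 + m.1.2)%N.
  by rewrite addnACA subnKC ?addnA// -ltnS.
rewrite add1n; field.
by rewrite -!natrD ?nat1r !pnatr_eq0 ?addSn.
Qed.

Lemma hilbert_moment_fraction (a : nat) (p q : R) :
  \sum_(i < k.+1) g i * (p / i.+1%:R + q / (i + a.+1).+1%:R) =
  p * M 0 + q * M a.+1.
Proof.
rewrite /M !mulr_sumr -big_split/=; apply: eq_bigr => i _.
by rewrite addn0 mulrDr; congr (_ + _); rewrite mulrCA.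
Qed.

(** The last factor is an integration by parts: int_0^1 G t^a dt = (G(1) - int_0^1 g t^(a + 1) dt) /
    (a + 1), with G(1) = M 0. On coefficients it is a partial fraction decomposition. *)
Lemma Gseq_slab_moment H c m :
  \sum_(t <- Gseq c) t.1 * slab_moment H (madd t.2 m) =
  c * H / (k + m.1.1 + m.1.2).+3%:R * K (k + m.1.1 + m.1.2).+3 m.2 *
    ((M 0 - M m.1.1.+1) / m.1.1.+1%:R).
Proof.
have -> : (M 0 - M m.1.1.+1) / m.1.1.+1%:R =
    m.1.1.+1%:R^-1 * M 0 + (- m.1.1.+1%:R^-1) * M m.1.1.+1.
  by field; rewrite nat1r pnatr_eq0.
rewrite -hilbert_moment_fraction big_map big_mkord mulr_sumr.
apply: eq_bigr => i _ /=; rewrite /slab_moment /madd/=.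
have -> : (i.+1 + m.1.1 + (k - i + m.1.2) = (k + m.1.1 + m.1.2).+1)%N.
  by rewrite !addSn addnACA subnKC ?addnA// -ltnS.
rewrite add0n addnS; field.
by rewrite -!natrD ?nat1r !pnatr_eq0 ?addSn.
Qed.

(** The last factor comes from Euler's identity at y = 1, dG/dy = (k + 1) G - t g, combined with the
    integration by parts for G. *)
Lemma dGseq_slab_moment H m :
  \sum_(t <- dGseq) t.1 * slab_moment H (madd t.2 m) =
  H / (k + m.1.1 + m.1.2).+2%:R * K (k + m.1.1 + m.1.2).+2 m.2 *
    ((k.+1%:R * M 0 - (k + m.1.1).+2%:R * M m.1.1.+1) / m.1.1.+1%:R).
Proof.
have -> : (k.+1%:R * M 0 - (k + m.1.1).+2%:R * M m.1.1.+1) / m.1.1.+1%:R =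
    (k.+1%:R / m.1.1.+1%:R) * M 0 + (- (k + m.1.1).+2%:R / m.1.1.+1%:R) * M m.1.1.+1.
  by field; rewrite nat1r pnatr_eq0.
rewrite -hilbert_moment_fraction big_map big_mkord mulr_sumr.
rewrite big_ord_recr/=.
(* The term i = k, left out of [dGseq], contributes zero to the right-hand side. *)
have -> : k.+1%:R / m.1.1.+1%:R / k.+1%:R +
    - (k + m.1.1).+2%:R / m.1.1.+1%:R / (k + m.1.1.+1).+1%:R = 0 :> R.
  rewrite addnS; field.
  by rewrite -!natrD ?nat1r !pnatr_eq0 ?addSn.
rewrite !mulr0 addr0; apply: eq_bigr => i _; rewrite /slab_moment /madd/=.
have ik := ltn_ord i.
have -> : (i.+1 + m.1.1 + (k - i.+1 + m.1.2) = k + m.1.1 + m.1.2)%N.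
  by rewrite addnACA subnKC// addnA.
rewrite add0n addnS natrB ?(ltnW ik)//; field.
by rewrite -!natrD ?nat1r !pnatr_eq0 ?addSn.
Qed.

Lemma gseq_tri_moment c m :
  \sum_(t <- gseq c) t.1 * tri_moment (madd t.2 m) =
  c * K (k + m.1.1 + m.1.2).+1 m.2 * M m.1.1.
Proof.
rewrite big_map big_mkord mulr_sumr; apply: eq_bigr => i _ /=.
rewrite /tri_moment /madd/=.
have -> : (i + m.1.1 + (k - i + m.1.2) = k + m.1.1 + m.1.2)%N.
  by rewrite addnACA subnKC ?addnA// -ltnS.
rewrite add0n; field.
by rewrite -!natrD ?nat1r !pnatr_eq0 ?addSn.
Qed.

Lemma zgseq_tri_moment c m :
  \sum_(t <- zgseq c) t.1 * tri_moment (madd t.2 m) =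
  c * K (k + m.1.1 + m.1.2).+1 m.2.+1 * M m.1.1.
Proof.
rewrite big_map big_mkord mulr_sumr; apply: eq_bigr => i _ /=.
rewrite /tri_moment /madd/=.
have -> : (i + m.1.1 + (k - i + m.1.2) = k + m.1.1 + m.1.2)%N.
  by rewrite addnACA subnKC ?addnA// -ltnS.
rewrite add1n; field.
by rewrite -!natrD ?nat1r !pnatr_eq0 ?addSn.
Qed.

Hypothesis Mlt : forall a, (a < k)%N -> M a = 0.

(** Here k > 0, so M 0 = 0. Both sides are then multiples of M (a + 1), which vanishes unless the
    test monomial is x1^(k - 1); in that case 2 k + 3 cancels the factor from [beta_int0]. *)
Lemma Gseq_dGseq_moment H m : (mtot m < k)%N ->
  \sum_(t <- Gseq (2 * k + 3)%:R) t.1 * slab_moment H (madd t.2 m) =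
  \sum_(t <- dGseq) t.1 * slab_moment H (madd t.2 m).
Proof.
move=> mk; rewrite Gseq_slab_moment dGseq_slab_moment.
rewrite (Mlt (leq_ltn_trans _ mk))//.
move: m mk => [[a b] c]; rewrite /mtot/= => mk.
have [ak|] := ltnP a.+1 k; first by rewrite (Mlt ak) !(mulr0, subr0, mul0r).
move=> ka.
have [ak b0 c0] : [/\ k = a.+1, b = 0%N & c = 0%N] by split; lia.
rewrite b0 c0 !beta_int0 ak.
have -> : (2 * a.+1 + 3 = (a.+1 + a + 0).+4)%N by lia.
rewrite !addn0.
field.
by rewrite ?nat1r -!natrD ?nat1r !pnatr_eq0 ?addSn.
Qed.

(** Only the test monomial x1^k sees g, and there the quotient of [beta_int0] by [beta_int1] at m =
    2 k + 1 is 2 k + 3. *)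
Lemma gseq_zgseq_moment m : (mtot m <= k)%N ->
  \sum_(t <- gseq 1) t.1 * tri_moment (madd t.2 m) =
  \sum_(t <- zgseq (2 * k + 3)%:R) t.1 * tri_moment (madd t.2 m).
Proof.
move: m => [[a b] c]; rewrite /mtot => mk.
rewrite gseq_tri_moment zgseq_tri_moment /=.
have [ak|] := ltnP a k; first by rewrite (Mlt ak) !mulr0.
move=> ka; have [ak b0 c0] : [/\ a = k, b = 0%N & c = 0%N] by move: mk => /=; split; lia.
rewrite ak b0 c0 beta_int0 beta_int1 addn0.
have -> : (2 * k + 3 = (k + k).+3)%N by lia.
field.
by rewrite ?nat1r -!natrD ?nat1r !pnatr_eq0 ?addSn.
Qed.

End counterexample.

(** There are k linear conditions on k + 1 coefficients: a matrix with more rows than columns has a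
    nonzero left kernel. *)
Lemma hilbert_kernel (R : realType) (k : nat) :
  exists2 g : nat -> R, exists2 i, (i <= k)%N & g i != 0 &
    forall a, (a < k)%N -> hilbert_moment k g a = 0.
Proof.
pose A : 'M[R]_(k.+1, k) := \matrix_(i, a) (i + a).+1%:R^-1.
have /rowV0Pn[v /sub_kermxP vA v0] : kermx A != 0.
  by rewrite kermx_eq0 /row_free neq_ltn ltnS rank_leq_col.
exists (fun i => v 0 (inord i)).
  have /rV0Pn[i vi] := v0.
  by exists i; rewrite ?inord_val// -ltnS.
move=> a ak; move/rowP: vA => /(_ (Ordinal ak)); rewrite !mxE => <-.
by apply: eq_bigr => i _; rewrite inord_val mxE.
Qed.

Lemma eq_R3 (R : realType) (x y : R3 R) :
  x.1.1 = y.1.1 -> x.1.2 = y.1.2 -> x.2 = y.2 -> x = y.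
Proof. by move: x y => [[? ?] ?] [[? ?] ?] /= -> -> ->. Qed.

Section geometry.
Variables (R : realType) (H : R).
Local Notation V := (Ttilde (sides H)).

Lemma TtildeE (i : 'I_4) : V i =
  match val i with
  | 0 => (0, 0, 0) | 1 => (1, H, 0) | 2 => (0, H, 0) | _ => (0, 0, 1)
  end.
Proof.
case: i => [[|[|[|[|//]]]] i4]; rewrite /Ttilde /evec /sides/=;
  apply: eq_R3; rewrite /= /GRing.scale/= ?mulr0 ?mulr1 ?addr0 ?add0r//.
Qed.

Lemma tetra_slab : 0 < H -> tetra V = slab H.
Proof.
move=> H0; have Hn0 : H != 0 by rewrite gt_eqF.
have sumV (c : 'I_4 -> R) : \sum_i c i *: V i =
    (c 1, H * (c 1 + c 2%:R), c 3%:R) :> R3 R.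
  rewrite !big_ord_recl big_ord0 !TtildeE/=.
  have -> : lift ord0 ord0 = 1 :> 'I_4 by exact/val_inj.
  have -> : lift ord0 (lift ord0 ord0) = 2%:R :> 'I_4 by exact/val_inj.
  have -> : lift ord0 (lift ord0 (lift ord0 ord0)) = 3%:R :> 'I_4.
    by exact/val_inj.
  apply: eq_R3; rewrite /= /GRing.scale/=; ring.
apply/seteqP; split => [x [c [c0 c1 ->]]|x [x0 xy z0 yz]].
  rewrite sumV; split => //=.
  - by rewrite mulrC mulKf// lerDl.
  - rewrite mulrC mulKf// -c1 !big_ord_recl big_ord0 addr0.
    have -> : lift ord0 ord0 = 1 :> 'I_4 by exact/val_inj.
    have -> : lift ord0 (lift ord0 ord0) = 2%:R :> 'I_4 by exact/val_inj.
    have -> : lift ord0 (lift ord0 (lift ord0 ord0)) = 3%:R :> 'I_4.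
      by exact/val_inj.
    by rewrite -addrA lerDr.
(* The barycentric coordinates of x, whose nonnegativity is exactly the four inequalities of
   [slab]. *)
exists (fun i => match val i with
  | 0 => 1 - x.1.2 / H - x.2 | 1 => x.1.1 | 2 => x.1.2 / H - x.1.1
  | _ => x.2 end).
split.
- by case=> [[|[|[|[|//]]]] i4] /=; lra.
- by rewrite !big_ord_recl big_ord0 /=; ring.
rewrite sumV /=; case: x x0 xy z0 yz => [[x y] z] /= *.
apply: eq_R3 => //=.
by rewrite addrCA subrr addr0 mulrC divfK.
Qed.

Lemma face_cross0 : face_cross V 0 = (0, 1, H).
Proof.
by rewrite /face_cross /cross !TtildeE/=; apply: eq_R3; rewrite /=; ring.
Qed.

Lemma face_cross1 : face_cross V 1 = (H, 0, 0).
Proof.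
by rewrite /face_cross /cross !TtildeE/=; apply: eq_R3; rewrite /=; ring.
Qed.

Lemma face_cross2 : face_cross V 2%:R = (H, -1, 0).
Proof.
by rewrite /face_cross /cross !TtildeE/=; apply: eq_R3; rewrite /=; ring.
Qed.

Lemma face_cross3 : face_cross V 3%:R = (0, 0, H).
Proof.
by rewrite /face_cross /cross !TtildeE/=; apply: eq_R3; rewrite /=; ring.
Qed.

Lemma face_param0 s : face_param V 0 s = (1 - s.1 - s.2, H * (1 - s.2), s.2).
Proof.
by rewrite /face_param !TtildeE/=; apply: eq_R3; rewrite /= /GRing.scale/=; ring.
Qed.

Lemma face_param1 s : face_param V 1 s = (0, H * s.1, s.2).
Proof.
by rewrite /face_param !TtildeE/=; apply: eq_R3; rewrite /= /GRing.scale/=; ring.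
Qed.

Lemma face_param2 s : face_param V 2%:R s = (s.1, H * s.1, s.2).
Proof.
by rewrite /face_param !TtildeE/=; apply: eq_R3; rewrite /= /GRing.scale/=; ring.
Qed.

Lemma face_param3 s : face_param V 3%:R s = (s.1, H * (s.1 + s.2), 0).
Proof.
by rewrite /face_param !TtildeE/=; apply: eq_R3; rewrite /= /GRing.scale/=; ring.
Qed.

End geometry.

(** The map [phi] lets one statement serve the tetrahedron ([phi] the identity) and the faces ([phi]
    a parametrisation). *)
Lemma has_integral_prod d (T : measurableType d) (R : realType)
    (mu : {measure set T -> \bar R}) (D : set T) (phi : T -> R3 R)
    (I : nat * nat * nat -> R) (H : R) (s q : seq (R * (nat * nat * nat))) :
  measurable D ->
  (forall m, has_integral mu D (fun x => mon H m (phi x)) (I m)) ->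
  has_integral mu D (fun x => lc H s (phi x) * lc H q (phi x))
    (\sum_(r <- q) r.1 * \sum_(t <- s) t.1 * I (madd t.2 r.2)).
Proof.
move=> mD hI.
apply: (@eq_has_integral _ _ _ _ _ mD (fun x => \sum_(r <- q) r.1 * \sum_(t <- s)
    t.1 * mon H (madd t.2 r.2) (phi x))).
  move=> x _; rewrite /lc [RHS]mulr_sumr; apply: eq_bigr => r _.
  rewrite [RHS]mulrCA; congr (_ * _); rewrite mulr_suml; apply: eq_bigr => t _.
  by rewrite -mulrA; congr (_ * _); rewrite /mon !exprD/=; ring.
apply: has_integral_sum => // r _; apply: has_integralZ => //.
by apply: has_integral_sum => // t _; exact: has_integralZ.
Qed.

Section diagonal.
Variables (R : realType) (H : R) (k : nat) (g : nat -> R) (x : R3 R).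
Hypotheses (xH : x.1.2 / H = x.1.1).

(** Euler's identity restricted to x1 = y, obtained coefficientwise from (k - i) / (i + 1) + 1 = (k
    + 1) / (i + 1). *)
Lemma lc_dGseq_diag (c : R) : c * lc H (dGseq k g) x + lc H (gseq k g c) x =
  c * k.+1%:R * hilbert_moment k g 0 * x.1.1 ^+ k.
Proof.
rewrite /lc !big_map !big_mkord /hilbert_moment.
rewrite !mulr_sumr mulr_suml [in RHS]big_ord_recr [X in _ + X = _]big_ord_recr/= addrA.
rewrite -big_split/=; congr (_ + _); last first.
  rewrite /mon/= xH subnn addn0 !expr0 !mulr1; field.
  by rewrite nat1r pnatr_eq0.
apply: eq_bigr => i _; rewrite /mon/= xH expr0 !mulr1 -!exprD subnKC//.
rewrite subnKC ?(ltnW (ltn_ord i))// addn0 natrB ?(ltnW (ltn_ord i))//; field.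
by rewrite nat1r pnatr_eq0.
Qed.

Lemma lc_Gseq_diag (c : R) : lc H (Gseq k g c) x =
  c * hilbert_moment k g 0 * x.1.1 ^+ k.+1.
Proof.
rewrite /lc big_map big_mkord /hilbert_moment mulr_sumr mulr_suml.
apply: eq_bigr => i _; rewrite /mon/= xH expr0 mulr1 -exprD addSn addn0 subnKC; first by ring.
by rewrite -ltnS.
Qed.

End diagonal.

(** * The moments that identify v as the interpolation of u *)

Section interpolation.
Variables (R : realType) (H : R) (k : nat) (g : nat -> R).
Hypotheses (H0 : 0 < H) (Mlt : forall a, (a < k)%N -> hilbert_moment k g a = 0).
Local Notation V := (Ttilde (sides H)).
Local Notation c := ((2 * k + 3)%:R : R).

Definition ufield (j : 'I_3) : R3 R -> R :=
  match val j with
  | 0 => lc H (Gseq k g c) | 1 => lc H [::] | _ => lc H (zgseq k g (- c))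
  end.

Definition vfield (j : 'I_3) : R3 R -> R :=
  match val j with
  | 0 => lc H (dGseq k g) | 1 => lc H (gseq k g (- H)) | _ => lc H [::]
  end.

Lemma measurable_face_param (a : 'I_4 -> R3 R) (i : 'I_4) :
  measurable_fun setT (face_param a i).
Proof.
have maff (p q r : R) : measurable_fun setT (fun s : R * R => p + s.1 * q + s.2 * r).
  by apply: measurable_funD; [apply: measurable_funD => //|]; apply: measurable_funM.
pose A0 := a (lift i 0); pose A1 := a (lift i 1); pose A2 := a (lift i 2%:R).
have -> : face_param a i = fun s =>
    ((A0.1.1 + s.1 * (A1.1.1 - A0.1.1) + s.2 * (A2.1.1 - A0.1.1),
      A0.1.2 + s.1 * (A1.1.2 - A0.1.2) + s.2 * (A2.1.2 - A0.1.2)),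
     A0.2 + s.1 * (A1.2 - A0.2) + s.2 * (A2.2 - A0.2)).
  by apply/funext => s; exact: eq_R3.
by apply: measurable_fun_pair; [apply: measurable_fun_pair|]; exact: maff.
Qed.

(** A smooth function is its own trace, approximated by a constant sequence. *)
Lemma is_trace_lc (i : 'I_4) s :
  is_trace V i (lc H s) (fun j => 'D_(evec R j) (lc H s)) (lc H s).
Proof.
have N0 (f : R3 R -> R) : Lpnorm (tetra V) 1 (f \- f) = 0%E.
  rewrite /Lpnorm (_ : _ \_ _ = cst 0%E) ?Lnorm0//.
  by apply/funext => x; rewrite patchE/= subrr; case: ifP.
split.
  apply: measurable_funTS; apply: measurableT_comp (measurable_lc H s) _.
  exact: measurable_face_param.
exists (fun=> lc H s); split => [n|||].
- exact: smooth_lc.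
- by rewrite N0; exact: cvg_cst.
- by move=> j; rewrite N0; exact: cvg_cst.
- rewrite (_ : face_integral _ _ _ = 0%E); first exact: cvg_cst.
  rewrite /face_integral; under eq_integral do rewrite subrr normr0.
  by rewrite integral0 mule0.
Qed.

Lemma RTspace_vfield : is_RTspace k (slab H) vfield.
Proof.
(* Both dG/dy and g have degree k, so v needs no radial part. *)
exists vfield, (lc H [::]); split; last first.
- by move=> i x _; rewrite lc_nil mulr0 addr0.
- exact: is_poly_lc.
- case=> [[|[|[|//]]] i3]; rewrite /vfield/=; apply: is_poly_lc => //;
  rewrite all_map; apply/allP => i; rewrite mem_index_iota /mtot/= => ik; lia.
Qed.

(** For the second and third components the common value is 0: a test monomial of degree below k has
    a power of x1 below k, to which g is orthogonal. The first component is [Gseq_dGseq_moment]. *)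
Lemma interior_moments (j : 'I_3) (q : R3 R -> R) : is_poly k (slab H) q ->
  exists r, has_integral (@leb3 R) (slab H) (fun x => vfield j x * q x) r /\
    has_integral (@leb3 R) (slab H) (fun x => ufield j x * q x) r.
Proof.
move=> /(lc_is_poly (lt0r_neq0 H0))[l /allP lk ql].
have mS := measurable_slab H.
have hI m : has_integral (@leb3 R) (slab H) (mon H m) (slab_moment H m).
  by case: m => [[a b] c]; exact: has_integral_mon.
have hp s : has_integral (@leb3 R) (slab H) (fun x => lc H s x * lc H l x)
    (\sum_(r <- l) r.1 * \sum_(t <- s) t.1 * slab_moment H (madd t.2 r.2)).
  exact: (@has_integral_prod _ _ _ (@leb3 R) _ id).
have eqq s r : has_integral (@leb3 R) (slab H) (fun x => lc H s x * lc H l x) r ->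
    has_integral (@leb3 R) (slab H) (fun x => lc H s x * q x) r.
  by apply: eq_has_integral => // x /set_mem xS; rewrite ql.
have hM (r : R * (nat * nat * nat)) : r \in l -> hilbert_moment k g r.2.1.1 = 0.
  by move=> rl; apply: Mlt; apply: leq_ltn_trans (lk _ rl); rewrite /mtot; lia.
have z0 : \sum_(r <- l) r.1 * \sum_(t <- [::]) t.1 * slab_moment H (madd t.2 r.2) = 0.
  by rewrite big1// => r _; rewrite big_nil mulr0.
case: j => [[|[|[|//]]] i3]; rewrite /vfield /ufield/=.
- eexists; split; first exact/eqq/hp.
  apply: eqq; have := hp (Gseq k g c); congr (has_integral _ _ _ _).
  by apply: eq_big_seq => r rl; rewrite Gseq_dGseq_moment//; exact: lk.
- exists 0; split; apply: eqq.
    have := hp (gseq k g (- H)); congr (has_integral _ _ _ _).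
    by rewrite big_seq big1// => r rl; rewrite gseq_slab_moment hM ?mulr0.
  by rewrite -[X in has_integral _ _ _ X]z0; exact: hp.
- exists 0; split; apply: eqq.
    by rewrite -[X in has_integral _ _ _ X]z0; exact: hp.
  have := hp (zgseq k g (- c)); congr (has_integral _ _ _ _).
  by rewrite big_seq big1// => r rl; rewrite zgseq_slab_moment hM ?mulr0.
Qed.

(** Both sides carry the same factor [(face_jac V i)^-1], so the fluxes can be compared along
    [face_cross], which is free of square roots. *)
Lemma eq_face_integral (i : 'I_4) (u v : 'I_3 -> R3 R -> R) (q : R3 R -> R) (r : R) :
  has_integral (@leb2 R) (@triangle R) (fun s =>
    (\sum_j v j (face_param V i s) * xcoord j (face_cross V i)) * q (face_param V i s)) r ->
  has_integral (@leb2 R) (@triangle R) (fun s =>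
    (\sum_j u j (face_param V i s) * xcoord j (face_cross V i)) * q (face_param V i s)) r ->
  face_integral V i (fun x => (\sum_j v j x * xcoord j (face_normal V i)) * q x) =
  face_integral V i (fun x => (\sum_j u j x * xcoord j (face_normal V i)) * q x).
Proof.
have mT : measurable (@triangle R) by exact: measurable_triangle.
have xZ (a : R) (x : R3 R) j : xcoord j (a *: x) = a * xcoord j x.
  by rewrite /xcoord; case: j => [[|[|[|//]]] ?].
have key w : has_integral (@leb2 R) (@triangle R) (fun s =>
    (\sum_j w j (face_param V i s) * xcoord j (face_cross V i)) * q (face_param V i s)) r ->
    (\int[@leb2 R]_(s in @triangle R)
      ((\sum_j w j (face_param V i s) * xcoord j (face_normal V i)) *
        q (face_param V i s))%:E = ((face_jac V i)^-1 * r)%:E)%E.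
  move=> hw; have [_ <-] := @has_integralZ _ _ _ (@leb2 R) _ mT (face_jac V i)^-1 _ _ hw.
  apply: eq_integral => s _; congr EFin; rewrite [RHS]mulrA; congr (_ * _).
  by rewrite mulr_sumr; apply: eq_bigr => j _; rewrite xZ mulrCA.
by move=> /key hv /key hu; rewrite /face_integral hv hu.
Qed.

Lemma sum3 (f : 'I_3 -> R) : \sum_i f i = f 0 + f 1 + f 2%:R.
Proof.
rewrite !big_ord_recl big_ord0 addr0 addrA.
by congr (f _ + f _ + f _); exact/val_inj.
Qed.

Lemma eq_face_integral_pointwise (i : 'I_4) (u v : 'I_3 -> R3 R -> R)
    (q : R3 R -> R) :
  (forall s, \sum_j v j (face_param V i s) * xcoord j (face_cross V i) =
             \sum_j u j (face_param V i s) * xcoord j (face_cross V i)) ->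
  face_integral V i (fun x => (\sum_j v j x * xcoord j (face_normal V i)) * q x) =
  face_integral V i (fun x => (\sum_j u j x * xcoord j (face_normal V i)) * q x).
Proof.
move=> uv; congr (_ * _)%E; apply: eq_integral => s _; congr (_ * _)%:E.
have xZ (a : R) (x : R3 R) j : xcoord j (a *: x) = a * xcoord j x.
  by rewrite /xcoord; case: j => [[|[|[|//]]] ?].
under eq_bigr do rewrite xZ mulrCA; under [RHS]eq_bigr do rewrite xZ mulrCA.
by rewrite -!mulr_sumr uv.
Qed.

Lemma poly_on_face (i : 'I_4) n (q : R3 R -> R) : is_poly n (face V i) q ->
  exists2 l, all (fun t => mtot t.2 < n)%N l &
    forall s, triangle s -> q (face_param V i s) = lc H l (face_param V i s).
Proof.
move=> /(lc_is_poly (lt0r_neq0 H0))[l lk ql]; exists l => // s Ts.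
by apply: ql; exists s.
Qed.

Lemma face_moments0 (q : R3 R -> R) : is_poly k.+1 (face V 0) q ->
  face_integral V 0
    (fun x => (\sum_j vfield j x * xcoord j (face_normal V 0)) * q x) =
  face_integral V 0
    (fun x => (\sum_j ufield j x * xcoord j (face_normal V 0)) * q x).
Proof.
move=> /poly_on_face[l /allP lk ql].
have mT : measurable (@triangle R) by exact: measurable_triangle.
have hI m : has_integral (@leb2 R) (@triangle R)
    (fun s => mon H m (face_param V 0 s)) (tri_moment R m).
  case: m => [[a b] c]; apply: eq_has_integral (has_integral_tmon R a b c) => //.
  by move=> s _; rewrite /tmon /mon face_param0/= [H * _]mulrC mulfK// lt0r_neq0.
have hp s : has_integral (@leb2 R) (@triangle R)
    (fun x => lc H s (face_param V 0 x) * lc H l (face_param V 0 x))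
    (\sum_(r <- l) r.1 * \sum_(t <- s) t.1 * tri_moment R (madd t.2 r.2)).
  exact: (@has_integral_prod _ _ _ (@leb2 R)).
apply: eq_face_integral.
  apply: eq_has_integral (hp (gseq k g (- H))) => // s /set_mem Ts.
  rewrite ql//; congr (_ * _).
  by rewrite sum3 face_cross0 /xcoord/= /vfield/= lc_nil/=; ring.
have := @has_integralZ _ _ _ (@leb2 R) _ mT H _ _ (hp (zgseq k g (- c))).
have -> : H * (\sum_(r <- l) r.1 * \sum_(t <- zgseq k g (- c))
      t.1 * tri_moment R (madd t.2 r.2)) =
    \sum_(r <- l) r.1 * \sum_(t <- gseq k g (- H)) t.1 * tri_moment R (madd t.2 r.2).
  rewrite mulr_sumr; apply: eq_big_seq => r rl.
  have := gseq_zgseq_moment Mlt (lk _ rl).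
  rewrite !gseq_tri_moment !zgseq_tri_moment mul1r => e.
  by rewrite -[- H * _ * _]mulrA e; ring.
apply: eq_has_integral => // s /set_mem Ts.
rewrite ql// mulrA; congr (_ * _).
by rewrite sum3 face_cross0 /xcoord/= /ufield/= lc_nil/=; ring.
Qed.

(** On x1 = 0 both fluxes vanish, since every monomial of G and of dG/dy contains x1. *)
Lemma face_moments1 (q : R3 R -> R) :
  face_integral V 1
    (fun x => (\sum_j vfield j x * xcoord j (face_normal V 1)) * q x) =
  face_integral V 1
    (fun x => (\sum_j ufield j x * xcoord j (face_normal V 1)) * q x).
Proof.
apply: eq_face_integral_pointwise => s.
rewrite !sum3 face_cross1 face_param1 /xcoord/= !mulr0 !addr0; congr (_ * _).
by rewrite /vfield /ufield/= /lc !big_map !big1// => i _;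
  rewrite /mon/= exprS !mul0r mulr0.
Qed.

(** On x3 = 0 the third component - c x3 g vanishes, and so does that of v. *)
Lemma face_moments3 (q : R3 R -> R) :
  face_integral V 3%:R
    (fun x => (\sum_j vfield j x * xcoord j (face_normal V 3%:R)) * q x) =
  face_integral V 3%:R
    (fun x => (\sum_j ufield j x * xcoord j (face_normal V 3%:R)) * q x).
Proof.
apply: eq_face_integral_pointwise => s.
rewrite !sum3 face_cross3 face_param3 /xcoord/= !mulr0 !add0r; congr (_ * _).
rewrite /vfield /ufield/= lc_nil /lc big_map big1// => i _.
by rewrite /mon/= expr1 !mulr0.
Qed.

Lemma face_moments2 (q : R3 R -> R) : is_poly k.+1 (face V 2%:R) q ->
  face_integral V 2%:R
    (fun x => (\sum_j vfield j x * xcoord j (face_normal V 2%:R)) * q x) =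
  face_integral V 2%:R
    (fun x => (\sum_j ufield j x * xcoord j (face_normal V 2%:R)) * q x).
Proof.
have Hs (s : R) : H * s / H = s by rewrite [H * _]mulrC mulfK// lt0r_neq0.
have [k0|k0] := posnP k; last first.
  move=> _; apply: eq_face_integral_pointwise => s.
  rewrite !sum3 face_cross2 face_param2 /xcoord/= !mulr0 !addr0 !mulrN1.
  have M0 := Mlt k0.
  have xH : H * s.1 / H = s.1 by exact: Hs.
  rewrite /vfield /ufield/= lc_nil/= oppr0 addr0.
  rewrite (@lc_Gseq_diag _ _ _ _ (s.1, H * s.1, s.2))// M0 mulr0 !mul0r.
  have := @lc_dGseq_diag _ H k g (s.1, H * s.1, s.2) xH H.
  rewrite M0 mulr0 mul0r => <-; rewrite mulrC; congr (_ + _).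
  by rewrite /lc -sumrN !big_map; apply: eq_bigr => i _; rewrite !mulNr opprK.
move=> /poly_on_face[l /allP lk ql].
have mT : measurable (@triangle R) by exact: measurable_triangle.
(* For k = 0 the test polynomial is the constant q0. *)
pose q0 := \sum_(r <- l) r.1.
have qq s : triangle s -> q (face_param V 2%:R s) = q0.
  move=> Ts; rewrite ql// /lc /q0; apply: eq_big_seq => r /lk.
  case: r => [a [[[|i] [|j]] [|n]]]; rewrite /mtot k0//= => _.
  by rewrite /mon/= !expr0 !mulr1.
(* The flux of v is the constant H g_0, that of u is 3 H g_0 s1. Since s1 = (1 - s2) - (1 - s1 -
   s2), its integral comes from two [tmon] moments, and the mean of s1 over the triangle is 1 /
   3. *)
have h1 := @has_integralZ _ _ _ (@leb2 R) _ mT (H * g 0%N * q0) _ _ (has_integral_tmon R 0 0 0).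
have h2 := @has_integralZ _ _ _ (@leb2 R) _ mT (3 * H * g 0%N * q0) _ _ (has_integral_tmon R 0 1 0).
have h3 := @has_integralZ _ _ _ (@leb2 R) _ mT (- (3 * H * g 0%N * q0)) _ _ (has_integral_tmon R 1 0 0).
have := @has_integralD _ _ _ (@leb2 R) _ mT _ _ _ _ h2 h3; rewrite !addn0 !add0n !beta_int0.
move: h1; rewrite !addn0 !beta_int0.
have -> : 3 * H * g 0%N * q0 * (1^-1 * 3%:R^-1) +
   - (3 * H * g 0%N * q0) * (2%:R^-1 * 3%:R^-1) = H * g 0%N * q0 * (1^-1 * 2%:R^-1).
  by field.
move=> h1 h23; apply: eq_face_integral.
  apply: eq_has_integral h1 => // s /set_mem Ts; rewrite qq//.
  rewrite sum3 face_cross2 face_param2 /xcoord/= /vfield/= lc_nil/= /lc.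
  rewrite !big_map k0 !big_mkord big_ord0 big_ord1 /mon /tmon/= !expr0; ring.
apply: eq_has_integral h23 => // s /set_mem Ts; rewrite qq//.
rewrite sum3 face_cross2 face_param2 /xcoord/= /ufield/= lc_nil/= /lc.
rewrite !big_map k0 !big_mkord big_ord1 /mon /tmon/= !expr0 !expr1 muln0 add0n.
by field.
Qed.

Lemma is_RTinterp_vfield :
  is_RTinterp k V ufield (fun i j => 'D_(evec R j) (ufield i)) vfield.
Proof.
have tr i : forall j, is_trace V i (ufield j) (fun l => 'D_(evec R l) (ufield j)) (ufield j).
  by case=> [[|[|[|//]]] i3]; rewrite /ufield/=; exact: is_trace_lc.
split.
- by rewrite tetra_slab//; exact: RTspace_vfield.
- case=> [[|[|[|[|//]]]] i4]; exists ufield => //.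
  + have -> : Ordinal i4 = 0 by exact/val_inj.
    exact: face_moments0.
  + have -> : Ordinal i4 = 1 by exact/val_inj.
    by move=> q _; exact: face_moments1.
  + have -> : Ordinal i4 = 2%:R by exact/val_inj.
    exact: face_moments2.
  + have -> : Ordinal i4 = 3%:R by exact/val_inj.
    by move=> q _; exact: face_moments3.
- rewrite tetra_slab// => q qP.
  have mS := measurable_slab H.
  have [r0 [v0 u0]] := interior_moments 0 (qP 0).
  have [r1 [v1 u1]] := interior_moments 1 (qP 1).
  have [r2 [v2 u2]] := interior_moments 2%:R (qP 2%:R).
  have key w : has_integral (@leb3 R) (slab H) (fun x => w 0 x * q 0 x) r0 ->
    has_integral (@leb3 R) (slab H) (fun x => w 1 x * q 1 x) r1 ->
    has_integral (@leb3 R) (slab H) (fun x => w 2%:R x * q 2%:R x) r2 ->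
    \int[@leb3 R]_(x in slab H) (\sum_j w j x * q j x) = r0 + r1 + r2.
    move=> w0 w1 w2; apply: has_integral_Rintegral.
    have w01 := @has_integralD _ _ _ (@leb3 R) _ mS _ _ _ _ w0 w1.
    have w012 := @has_integralD _ _ _ (@leb3 R) _ mS _ _ _ _ w01 w2.
    by apply: eq_has_integral w012 => // x _; rewrite sum3.
  by rewrite !key.
Qed.

End interpolation.

(** * Weak derivatives of smooth functions *)

(** The difference quotients of [F \o p] at t and of F at [p t] along v are the same function. *)
Lemma is_derive_line (R : realType) (F : R3 R -> R) (p : R -> R3 R) (v : R3 R)
    (t : R) : (forall h, p (h + t) = h *: v + p t) -> derivable F (p t) v ->
  is_derive t (1 : R) (F \o p) ('D_v F (p t)).
Proof.
move=> pE dF.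
have E : (fun h : R => h^-1 *: (((F \o p) \o shift t) (h *: (1 : R)) - (F \o p) t)) =
    (fun h : R => h^-1 *: ((F \o shift (p t)) (h *: v) - F (p t))).
  by apply/funext => h /=; rewrite /shift/= -pE /GRing.scale/= mulr1.
apply: DeriveDef; first by rewrite /derivable E.
by rewrite /derive E.
Qed.

Section compact_support.
Variable R : realType.
Local Notation leb := (@lebesgue_measure R).

Definition cube1 (M : R) : set R := `[- M, M]%classic.
Definition cube2 (M : R) : set (R * R) := cube1 M `*` cube1 M.
Definition cube3 (M : R) : set (R3 R) := cube2 M `*` cube1 M.

Lemma measurable_cube3 M : measurable (cube3 M).
Proof.
by apply: measurableX; [apply: measurableX|]; exact: measurable_itv.
Qed.

Lemma leb_cube1 M : (leb (cube1 M) < +oo)%E.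
Proof. by rewrite lebesgue_measure_itv/=; case: ifP; rewrite ?ltry. Qed.

Lemma leb2_cube2 M : (@leb2 R (cube2 M) < +oo)%E.
Proof.
rewrite /leb2 product_measure1E; [|exact: measurable_itv..].
by rewrite lte_mul_pinfty ?ge0_fin_numE ?leb_cube1.
Qed.

Lemma leb3_cube3 M : (@leb3 R (cube3 M) < +oo)%E.
Proof.
rewrite /leb3 product_measure1E; [|apply: measurableX; exact: measurable_itv|exact: measurable_itv].
by rewrite lte_mul_pinfty ?ge0_fin_numE ?leb_cube1 ?leb2_cube2.
Qed.

Lemma integrable_bounded_support d (T : measurableType d)
    (mu : {measure set T -> \bar R}) (A : set T) (f : T -> R) (B : R) :
  measurable A -> (mu A < +oo)%E -> measurable_fun setT f ->
  (forall x, `|f x| <= B) -> (forall x, ~ A x -> f x = 0) ->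
  mu.-integrable setT (EFin \o f).
Proof.
move=> mA Aoo mf fB f0.
have -> : EFin \o f = (EFin \o f) \_ A.
  apply/funext => x; rewrite patchE; case: ifPn => // /negP xA /=.
  by rewrite f0// => /mem_set.
apply/(integrable_mkcond (EFin \o f) mA).
apply: (measurable_bounded_integrable mA Aoo); first exact: measurable_funTS.
exists B; split; first by rewrite num_real.
by move=> C BC x _ /=; apply: le_trans (ltW BC).
Qed.

(** The fundamental theorem on [-M, M]; the condition on G includes the endpoints, where it is
    evaluated. *)
Lemma integral_derive_compact (G G' : R -> R) (M : R) : 0 <= M ->
  (forall t : R, is_derive t 1 G (G' t)) -> continuous G' ->
  (forall t, M <= `|t| -> G t = 0) -> (forall t, M < `|t| -> G' t = 0) ->
  (\int[leb]_t (G' t)%:E = 0)%E.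
Proof.
move=> M0 dG cG G0 G'0.
transitivity (\int[leb]_(t in `[(- M)%R, M]) (G' t)%:E)%E.
  rewrite [RHS]integral_mkcond; apply: eq_integral => t _; rewrite patchE.
  case: ifPn => // tM; rewrite G'0// ltNge; apply: contra tM.
  by rewrite ler_norml mem_setE in_itv/=.
rewrite (integral_derive _ dG cG); last by lra.
by rewrite !G0 ?subrr// ?normrN ger0_norm.
Qed.

Lemma norm_R3_le (x : R3 R) (M : R) :
  (`|x| <= M) = [&& `|x.1.1| <= M, `|x.1.2| <= M & `|x.2| <= M].
Proof. by rewrite !prod_normE/= !ge_max andbA. Qed.

Lemma cube3_norm (x : R3 R) M : cube3 M x <-> `|x| <= M.
Proof.
rewrite norm_R3_le !ler_norml /cube3 /cube2 /cube1/= !in_itv/=; split.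
  by move=> [[-> ->] ->].
by case/and3P.
Qed.

Lemma continuous_line (h : R3 R -> R) (p : R -> R3 R) : continuous h ->
  continuous (fun t => (p t).1.1) -> continuous (fun t => (p t).1.2) ->
  continuous (fun t => (p t).2) -> continuous (h \o p).
Proof.
move=> ch c1 c2 c3 t.
have pE : p = fun t => ((p t).1.1, (p t).1.2, (p t).2).
  by apply/funext => u; case: (p u) => [[]].
apply: continuous_comp; last exact: ch.
rewrite pE; exact: (cvg_pair (cvg_pair (c1 t) (c2 t)) (c3 t)).
Qed.

(** Fubini's theorem with coordinate j integrated first: that integral vanishes along each line. The
    integrand changes sign, hence the preliminary bound and the integrability. *)
Lemma integral_partial_eq0 (F : R3 R -> R) (j : 'I_3) (M : R) : 0 <= M ->
  (forall x, differentiable F x) -> continuous ('D_(evec R j) F) ->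
  (forall x, M <= `|x| -> F x = 0) ->
  (@leb3 R).-integrable setT (EFin \o 'D_(evec R j) F) /\
  (\int[@leb3 R]_x ('D_(evec R j) F x)%:E = 0)%E.
Proof.
move=> M0 dF ch F0; set h := 'D_(evec R j) F.
have h0 x : M < `|x| -> h x = 0.
  move=> Mx; rewrite /h -(@derive_cst _ _ _ (0 : R) x (evec R j)).
  apply: near_eq_derive.
  have Mnear : \forall y \near x, M < `|y|.
    by have /cvgr_gt := @norm_continuous _ _ x; exact.
  by apply: filterS Mnear => y My; rewrite F0// ltW.
have [B hB] : exists B, forall x, `|h x| <= B.
  have cK : compact (cube3 M).
    by apply: compact_setX; [apply: compact_setX|]; exact: segment_compact.
  have [B [_ hB]] := compact_bounded
    (continuous_compact (continuous_subspaceT ch) cK).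
  exists (`|B| + 1) => x; have [xM|xM] := leP `|x| M.
    apply: hB; first by rewrite (le_lt_trans (ler_norm _))// ltrDl.
    by exists x => //; exact/cube3_norm.
  by rewrite h0// normr0 addr_ge0.
have mh : measurable_fun setT h by exact: continuous_measurable_fun3.
have h0' x : ~ cube3 M x -> h x = 0.
  by move=> /cube3_norm/negP; rewrite -ltNge => /h0.
have ih : (@leb3 R).-integrable setT (EFin \o h).
  apply: (@integrable_bounded_support _ _ (@leb3 R) (cube3 M) h B) => //.
  - exact: measurable_cube3.
  - exact: leb3_cube3.
split => //.
(* The last premise makes the line leave the support of F as soon as [|t|] reaches M. *)
have line (p : R -> R3 R) : (forall t s, p (s + t) = s *: evec R j + p t) ->
    continuous (fun t => (p t).1.1) -> continuous (fun t => (p t).1.2) ->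
    continuous (fun t => (p t).2) -> (forall t, `|t| <= `|p t|) ->
    (\int[leb]_t (h (p t))%:E = 0)%E.
  move=> pE c1 c2 c3 tp.
  apply: (@integral_derive_compact (F \o p) (h \o p) M) => //.
  - by move=> t; apply: is_derive_line => //; exact: diff_derivable.
  - exact: continuous_line.
  - by move=> t Mt; apply: F0; apply: le_trans (tp t).
  - by move=> t Mt; apply: h0; apply: lt_le_trans (tp t).
have norm_le (x : R3 R) : [/\ `|x.1.1| <= `|x|, `|x.1.2| <= `|x| & `|x.2| <= `|x|].
  by have := lexx `|x|; rewrite {1}norm_R3_le => /and3P.
have ih2 z : (@leb2 R).-integrable setT (EFin \o (fun xy => h (xy, z))).
  apply: (@integrable_bounded_support _ _ (@leb2 R) (cube2 M) _ B) => //.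
  - by apply: measurableX; exact: measurable_itv.
  - exact: leb2_cube2.
  - by apply: (measurableT_comp mh); exact: measurable_fun_pair.
  - by move=> x xM; apply: h0' => -[].
have [j0|[j1|j2]] : j = 0 \/ j = 1 \/ j = 2%:R.
- by case: (j) => [[|[|[|//]]] ?]; [left|right; left|right; right]; exact/val_inj.
- rewrite -(@integral21_prod_meas1 _ _ _ _ R (@leb2 R) leb _ ih).
  apply: integral0_eq => z _; rewrite /fubini_G.
  rewrite -(@integral21_prod_meas1 _ _ _ _ R leb leb _ (ih2 z)).
  apply: integral0_eq => y _; rewrite /fubini_G.
  apply: (line (fun t => (t, y, z))); last by move=> t; have [] := norm_le (t, y, z).
  + by move=> t s; rewrite j0; apply: eq_R3; rewrite /= /GRing.scale/= ?mulr1 ?mulr0 ?add0r.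
  + by move=> t.
  + by move=> t; exact: cvg_cst.
  + by move=> t; exact: cvg_cst.
- rewrite -(@integral21_prod_meas1 _ _ _ _ R (@leb2 R) leb _ ih).
  apply: integral0_eq => z _; rewrite /fubini_G.
  rewrite -(@integral12_prod_meas1 _ _ _ _ R leb leb _ (ih2 z)).
  apply: integral0_eq => y _; rewrite /fubini_F.
  apply: (line (fun t => (y, t, z))); last by move=> t; have [] := norm_le (y, t, z).
  + by move=> t s; rewrite j1; apply: eq_R3; rewrite /= /GRing.scale/= ?mulr1 ?mulr0 ?add0r.
  + by move=> t; exact: cvg_cst.
  + by move=> t.
  + by move=> t; exact: cvg_cst.
- rewrite -(@integral12_prod_meas1 _ _ _ _ R (@leb2 R) leb _ ih).
  apply: integral0_eq => -[x y] _; rewrite /fubini_F.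
  apply: (line (fun t => (x, y, t))); last by move=> t; have [] := norm_le (x, y, t).
  + by move=> t s; rewrite j2; apply: eq_R3; rewrite /= /GRing.scale/= ?mulr1 ?mulr0 ?add0r.
  + by move=> t; exact: cvg_cst.
  + by move=> t; exact: cvg_cst.
  + by move=> t.
Qed.

End compact_support.

(** The product f phi has compact support, so the integral of its partial derivative is 0; Leibniz'
    rule splits it into the two integrals to compare. *)
Lemma weak_partial_smooth (R : realType) (S : set (R3 R)) (j : 'I_3) (f : R3 R -> R) :
  measurable S -> smooth f -> is_weak_partial S j f ('D_(evec R j) f).
Proof.
move=> mS sf phi [sphi cK KS].
set K := closure _ in cK KS.
have df x := sf [::] x; have dphi x := sphi [::] x.
have ddf x := sf [:: j] x; have ddphi x := sphi [:: j] x.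
rewrite /= in df dphi ddf ddphi.
have phi0 x : ~ K x -> phi x = 0.
  move=> nK; apply/eqP/negPn/negP => px; apply: nK; exact: subset_closure.
have [M [_ KM]] := compact_bounded cK.
pose N := `|M| + 1.
have N0 : 0 < N by rewrite ltr_wpDl.
have KN x : K x -> `|x| <= N by apply: KM; rewrite (le_lt_trans (ler_norm _))// ltrDl.
have KN' x : N + 1 <= `|x| -> ~ K x.
  by move=> Nx /KN; apply/negP; rewrite -ltNge (lt_le_trans _ Nx)// ltrDl.
have Dphi0 x : ~ K x -> 'D_(evec R j) phi x = 0.
  move=> nK; rewrite -(@derive_cst _ _ _ (0 : R) x (evec R j)).
  apply: near_eq_derive.
  have : nbhs x (~` K) by apply: open_nbhs_nbhs; split => //; exact/closed_openC/closed_closure.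
  by apply: filterS => y /phi0.
have cf : continuous f by move=> x; exact: differentiable_continuous.
have cphi : continuous phi by move=> x; exact: differentiable_continuous.
have cDf : continuous ('D_(evec R j) f).
  by move=> x; exact: differentiable_continuous.
have cDphi : continuous ('D_(evec R j) phi).
  by move=> x; exact: differentiable_continuous.
pose a x := f x * 'D_(evec R j) phi x; pose b x := 'D_(evec R j) f x * phi x.
have ca : continuous a by move=> x; exact: (continuousM (cf x) (cDphi x)).
have cb : continuous b by move=> x; exact: (continuousM (cDf x) (cphi x)).
have cab : continuous (a \+ b) by move=> x; exact: (continuousD (ca x) (cb x)).
have DF : 'D_(evec R j) (f * phi) = a \+ b.
  apply/funext => x; rewrite deriveM; [|exact: diff_derivable..].
  by rewrite /a /b /GRing.scale/= [X in _ + X]mulrC.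
have [iF F0] : (@leb3 R).-integrable setT (EFin \o 'D_(evec R j) (f * phi)) /\
    (\int[@leb3 R]_x ('D_(evec R j) (f * phi) x)%:E = 0)%E.
  (* K may touch the sphere of radius N, where vanishing would already be required; N + 1 leaves
     room. *)
  apply: (@integral_partial_eq0 _ _ _ (N + 1)).
  - by rewrite addr_ge0// ltW.
  - by move=> x; exact: differentiableM.
  - by rewrite DF.
  - by move=> x Nx; rewrite !fctE phi0 ?mulr0//; exact: KN'.
(* As K lies inside S, integrals over S and over the whole space agree for functions vanishing off
   K. *)
have supp_int h : continuous h -> (forall x, ~ K x -> h x = 0) ->
    (@leb3 R).-integrable S (EFin \o h) /\
    \int[@leb3 R]_(x in S) h x = \int[@leb3 R]_x h x.
  move=> ch h0.
  have ih : (@leb3 R).-integrable setT (EFin \o h).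
    have [B [_ hB]] := compact_bounded
      (continuous_compact (continuous_subspaceT ch) cK).
    apply: (@integrable_bounded_support _ _ _ (@leb3 R) (cube3 N) h (`|B| + 1)) => //.
    - exact: measurable_cube3.
    - exact: leb3_cube3.
    - exact: continuous_measurable_fun3.
    - move=> x; have [Kx|nK] := pselect (K x); last by rewrite h0// normr0 addr_ge0.
      apply: hB; last by exists x.
      by rewrite (le_lt_trans (ler_norm _))// ltrDl.
    - by move=> x xN; apply: h0 => /KN /cube3_norm.
  split; first exact: integrableS ih.
  rewrite Rintegral_mkcond; apply: eq_Rintegral => x _; rewrite patchE.
  case: ifPn => // /negP xS; rewrite h0// => Kx; apply: xS; apply/mem_set.
  by apply: interior_subset; exact: KS.
have [|ia _] := supp_int a ca; first by move=> x nK; rewrite /a Dphi0// mulr0.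
have [|ib _] := supp_int b cb; first by move=> x nK; rewrite /b phi0// mulr0.
have [|_ eab] := supp_int (a \+ b) cab.
  by move=> x nK; rewrite /a /b /= Dphi0// phi0// !mulr0 addr0.
apply/eqP; rewrite -subr_eq0 opprK -[_ + _]RintegralD//; apply/eqP.
rewrite -[LHS]/(\int[@leb3 R]_(x in S) ((a \+ b) x)) eab.
by rewrite /Rintegral -DF F0.
Qed.

(** * Comparison of Lp norms *)

Section Lp_bounds.
Context d (T : measurableType d) (R : realType) (mu : {measure set T -> \bar R}).

Lemma le_Lnorm (p : \bar R) (f g : T -> \bar R) : (1 <= p)%E ->
  measurable_fun setT f -> measurable_fun setT g ->
  (forall x, `|f x| <= `|g x|)%E -> ('N[mu]_p[f] <= 'N[mu]_p[g])%E.
Proof.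
move=> p1 mf mg fg; rewrite unlock.
case: p p1 => [r| |//] r1; last first.
  by case: ifP => // _; apply: le_ess_sup; apply: nearW => x /=.
have r0 : 0 <= r by rewrite (le_trans ler01).
apply: gt0_ler_poweR; rewrite ?invr_ge0// ?in_itv/= ?leey ?andbT;
  try by apply: integral_ge0 => x _; exact: poweR_ge0.
apply: ge0_le_integral => //.
- by move=> x _; exact: poweR_ge0.
- by apply: (measurableT_comp (measurable_poweR r)); exact: measurableT_comp.
- by apply: (measurableT_comp (measurable_poweR r)); exact: measurableT_comp.
- by move=> x _; apply: gt0_ler_poweR => //; rewrite in_itv/= leey abse_ge0.
Qed.

(* The norm of the indicator function of a set of measure [m]. *)
Definition pscale (p : \bar R) (m : R) : R :=
  match p with EFin r => m `^ r^-1 | _ => 1 end.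

Lemma pscale_gt0 p m : 0 < m -> 0 < pscale p m.
Proof. by move=> m0; case: p => [r| |] //=; exact: powR_gt0. Qed.

(** For finite p this is c^(1/p) <= c; it compares a small box with one of volume H at a cost
    uniform in p. *)
Lemma pscale_le p c m : (1 <= p)%E -> 1 <= c -> 0 <= m ->
  pscale p (c * m) <= c * pscale p m.
Proof.
case: p => [r| |]//= p1 c1 m0; last by rewrite mulr1.
have r0 : 0 < r by rewrite (lt_le_trans ltr01).
have c0 : 0 <= c by rewrite (le_trans ler01).
rewrite powRM//; apply: ler_wpM2r; first exact: powR_ge0.
by apply: ler1_powR => //; rewrite invf_le1.
Qed.

Lemma Lnorm_cst_restrict (p : \bar R) (A : set T) (c m : R) : (1 <= p)%E ->
  measurable A -> mu A = m%:E -> 0 < m -> 0 <= c ->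
  'N[mu]_p[(EFin \o cst c) \_ A]%E = (c * pscale p m)%:E.
Proof.
move=> p1 mA mAm m0 c0.
have fE x : `|((EFin \o cst c) \_ A) x|%E = (((EFin \o cst c) \_ A) x).
  by rewrite patchE; case: ifP; rewrite ?abse0 ?gee0_abs ?lee_fin.
rewrite unlock; case: p p1 => [r| |//] p1; last first.
  have muT : (0 < mu setT)%E.
    apply: (@lt_le_trans _ _ (mu A)); first by rewrite mAm lte_fin.
    by apply: le_measure; rewrite ?inE//; exact: subsetT.
  rewrite muT /= mulr1; apply/eqP; rewrite eq_le; apply/andP; split.
    apply/ess_supP; apply: nearW => x /=; rewrite fE patchE.
    by case: ifP => _; rewrite lee_fin.
  rewrite leNgt; apply/negP => lt_c.
  (* The function is almost everywhere at most its essential supremum; were that below c, A would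
     lie in a null set. *)
  have := ess_sup_ge mu (abse \o ((EFin \o cst c) \_ A)) => -[N [mN N0 AN]].
  have : (mu A <= mu N)%E.
    apply: le_measure; rewrite ?inE// => x Ax; apply: AN => /=.
    rewrite fE patchE mem_set// => /(lt_le_trans lt_c).
    by rewrite ltxx.
  by rewrite N0 mAm lee_fin leNgt m0.
have r0 : 0 < r by rewrite (lt_le_trans ltr01).
transitivity ((\int[mu]_(x in A) (c `^ r)%:E) `^ r^-1)%E.
  congr poweR; rewrite [RHS]integral_mkcond; apply: eq_integral => x _.
  rewrite fE !patchE; case: ifP => // _.
  by rewrite poweR0r// gt_eqF.
rewrite integral_cst// mAm -EFinM poweR_EFin powRM ?powR_ge0 ?(ltW m0)//.
by rewrite -powRrM mulfV ?gt_eqF// powRr1.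
Qed.

End Lp_bounds.

Section Lpnorm_bounds.
Variable R : realType.

Lemma Lpnorm_le_cst (p : \bar R) (S A : set (R3 R)) (f : R3 R -> R) (c m : R) :
  (1 <= p)%E -> measurable S -> measurable A -> S `<=` A ->
  measurable_fun setT f -> (@leb3 R A = m%:E)%E -> 0 < m -> 0 <= c ->
  (forall x, S x -> `|f x| <= c) ->
  (Lpnorm S p f <= (c * pscale p m)%:E)%E.
Proof.
move=> p1 mS mA SA mf mAm m0 c0 fc.
rewrite -(@Lnorm_cst_restrict _ _ _ (@leb3 R) p A c m p1 mA mAm m0 c0) /Lpnorm.
apply: le_Lnorm => //.
- apply/(measurable_restrictT _ mS); apply/measurable_EFinP.
  exact: measurable_funTS.
- apply/(measurable_restrictT _ mA); apply/measurable_EFinP.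
  exact: measurable_funTS.
- move=> x; rewrite !patchE; case: ifPn => [/set_mem Sx|_].
    by rewrite mem_set ?lee_fin ?(ger0_norm c0) ?fc//; exact: SA.
  by rewrite abse0 abse_ge0.
Qed.

Lemma Lpnorm_ge_cst (p : \bar R) (S B : set (R3 R)) (f : R3 R -> R) (c m : R) :
  (1 <= p)%E -> measurable S -> measurable B -> B `<=` S ->
  measurable_fun setT f -> (@leb3 R B = m%:E)%E -> 0 < m -> 0 <= c ->
  (forall x, B x -> c <= `|f x|) ->
  ((c * pscale p m)%:E <= Lpnorm S p f)%E.
Proof.
move=> p1 mS mB BS mf mBm m0 c0 fc.
rewrite -(@Lnorm_cst_restrict _ _ _ (@leb3 R) p B c m p1 mB mBm m0 c0) /Lpnorm.
apply: le_Lnorm => //.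
- apply/(measurable_restrictT _ mB); apply/measurable_EFinP.
  exact: measurable_funTS.
- apply/(measurable_restrictT _ mS); apply/measurable_EFinP.
  exact: measurable_funTS.
- move=> x; rewrite !patchE; case: ifPn => [/set_mem Bx|_].
    by rewrite mem_set ?lee_fin ?(ger0_norm c0) ?fc//; exact: BS.
  by rewrite abse0 abse_ge0.
Qed.

End Lpnorm_bounds.

(** * Blow-up of the interpolation *)

Section blowup.
Variables (R : realType) (k : nat) (g : nat -> R).
Local Notation c := ((2 * k + 3)%:R : R).

Definition useq (i : 'I_3) : seq (R * (nat * nat * nat)) :=
  match val i with 0 => Gseq k g c | 1 => [::] | _ => zgseq k g (- c) end.

Lemma ufieldE H i : ufield H k g i = lc H (useq i).
Proof. by case: i => [[|[|[|//]]] ?]. Qed.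

Definition coef_norm (s : seq (R * (nat * nat * nat))) : R := \sum_(t <- s) `|t.1|.

Lemma coef_norm_ge0 s : 0 <= coef_norm s.
Proof. exact: sumr_ge0. Qed.

Lemma derive_lcE H s (j : 'I_3) (x : R3 R) :
  'D_(evec R j) (lc H s) x = (sides H j)^-1 * lc H (dlc j s) x.
Proof. by have := is_derive_lc H s j x => ?; rewrite derive_val. Qed.

Lemma div_ufield H x : \sum_i 'D_(evec R i) (ufield H k g i) x = 0.
Proof.
rewrite sum3 !ufieldE !derive_lcE.
have -> : useq 0 = Gseq k g c by [].
have -> : useq 1 = [::] by [].
have -> : useq 2%:R = zgseq k g (- c) by [].
have -> : sides H 0 = 1 by [].
have -> : sides H 2%:R = 1 by [].
rewrite !invr1 !mul1r (_ : dlc 1 [::] = [::])// lc_nil mulr0 addr0.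
rewrite /lc !big_map -big_split big1// => i _.
rewrite /mdec /mexp /mon/=.
have i0 : i.+1%:R != 0 :> R by rewrite pnatr_eq0.
by rewrite divfK//; ring.
Qed.

(** The polynomial g(., 1/2) is nonzero of degree at most k, so it cannot vanish at the k + 1 points
    1 / (j + 4); these are at most 1/4, away from the face x1 = y. *)
Lemma exists_nonzero_point : (exists2 i, (i <= k)%N & g i != 0) ->
  exists x0 : R, [/\ 0 < x0, x0 <= 4^-1 & lc 1 (gseq k g 1) (x0, 2^-1, 0) != 0].
Proof.
move=> [i ik gi].
pose p : {poly R} := \poly_(j < k.+1) (g j * 2^-1 ^+ (k - j)).
have p0 : p != 0.
  apply/eqP => /polyP/(_ i); rewrite coef_poly ltnS ik coef0 => /eqP.
  by rewrite mulf_eq0 (negbTE gi)/= expf_eq0 invr_eq0 pnatr_eq0 andbF.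
pose rs : seq R := [seq (j + 4)%:R^-1 | j <- iota 0 k.+1].
have urs : uniq rs.
  rewrite map_inj_uniq ?iota_uniq// => a b /invr_inj /eqP.
  by rewrite eqr_nat eqn_add2r => /eqP.
have : ~~ all (root p) rs.
  apply/negP => /(max_poly_roots p0)/(_ urs).
  rewrite size_map size_iota => /(leq_trans)/(_ (size_poly _ _)).
  by rewrite ltnn.
move=> /allPn[_ /mapP[j _ ->] nr]; exists ((j + 4)%:R^-1); split.
- by rewrite invr_gt0 ltr0n addn4.
- by rewrite lef_pV2 ?posrE ?ltr0n ?addn4// ler_nat.
- move: nr; apply: contra => /eqP e; apply/eqP; rewrite -[RHS]e.
  rewrite horner_poly /lc big_map big_mkord; apply: eq_bigr => l _.
  by rewrite /mon/= expr0 divr1; ring.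
Qed.

(** By continuity |g| stays above half its value nearby; z is free because g does not involve x3.
    The bounds on e keep the box inside the tetrahedron for heights up to 1/4. *)
Lemma exists_nonzero_box : (exists2 i, (i <= k)%N & g i != 0) ->
  exists x0 e del : R, [/\ 0 < e, 0 < del, e <= x0 <= 4^-1, e <= 8^-1 &
    forall x y z, x0 - e <= x <= x0 + e -> 2^-1 - e <= y <= 2^-1 + e ->
      del <= `|lc 1 (gseq k g 1) (x, y, z)|].
Proof.
move=> /exists_nonzero_point[x0 [x0gt x0le nz]].
set h := lc 1 (gseq k g 1) in nz *.
set P := (x0, 2^-1, 0) in nz.
have ch : {for P, continuous h}.
  exact/differentiable_continuous/differentiable_lc.
have hP : `|h P| / 2 < `|h P| by rewrite ltr_pdivrMr// ltr_pMr ?normr_gt0// ltr1n.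
have near_h : \forall x \near P, `|h P| / 2 < `|h x|.
  exact: (cvgr_norm_gt (h P) ch).
have /nbhs_ballP[d /= d0 dP] := near_h.
pose e := Num.min (d / 2) (Num.min x0 8^-1).
have e0 : 0 < e by rewrite !lt_min x0gt divr_gt0//= invr_gt0 ltr0n.
have ed : e <= d / 2 by rewrite ge_min lexx.
exists x0, e, (`|h P| / 2); split => //.
- by rewrite divr_gt0 ?normr_gt0.
- by rewrite x0le !ge_min lexx orbT.
- by rewrite !ge_min lexx !orbT.
move=> x y z /andP[x1 x2] /andP[y1 y2].
have -> : h (x, y, z) = h (x, y, 0).
  rewrite /h /lc !big_map; apply: eq_bigr => i _.
  by rewrite /mon/= !expr0.
apply/ltW/dP; split; [split|] => /=.
- by rewrite /ball/= ltr_distl; apply/andP; split; lra.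
- by rewrite /ball/= ltr_distl; apply/andP; split; lra.
- by rewrite /ball/= subrr normr0.
Qed.

Lemma leb3_box (a1 b1 a2 b2 a3 b3 : R) : a1 <= b1 -> a2 <= b2 -> a3 <= b3 ->
  (@leb3 R ((`[a1, b1] `*` `[a2, b2]) `*` `[a3, b3]) =
   ((b1 - a1) * (b2 - a2) * (b3 - a3))%:E)%E.
Proof.
move=> h1 h2 h3.
have itv (a b : R) : a <= b -> (@lebesgue_measure R `[a, b]%classic = (b - a)%:E)%E.
  rewrite le_eqVlt lebesgue_measure_itv/= lte_fin => /predU1P[->|->//].
  by rewrite ltxx subrr.
have box2 : (@leb2 R (`[a1, b1] `*` `[a2, b2]) = ((b1 - a1) * (b2 - a2))%:E)%E.
  rewrite /leb2 product_measure1E; [|exact: measurable_itv..].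
  by rewrite EFinM -!itv.
rewrite /leb3 product_measure1E; [|apply: measurableX; exact: measurable_itv|exact: measurable_itv].
by rewrite EFinM -box2 -itv.
Qed.

End blowup.

(** * Bounds for the norms of u and of its derivatives, and of v2 *)

Section norms.
Variables (R : realType) (k : nat) (g : nat -> R) (p : \bar R) (H : R).
Hypotheses (p1 : (1 <= p)%E) (H0 : 0 < H).
Local Notation u := (ufield H k g).
Local Notation V := (Ttilde (sides H)).

(** The tetrahedron is enclosed in the box [0, 1] x [0, H] x [0, 1], of volume H. *)
Lemma Lpnorm_slab_le (f : R3 R -> R) c : measurable_fun setT f -> 0 <= c ->
  (forall x, slab H x -> `|f x| <= c) ->
  (Lpnorm (slab H) p f <= (c * pscale p H)%:E)%E.
Proof.
move=> mf c0 fc.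
apply: (@Lpnorm_le_cst R p _ ((`[0, 1] `*` `[0, H]) `*` `[0, 1])) => //.
- exact: measurable_slab.
- by apply: measurableX; [apply: measurableX|]; exact: measurable_itv.
- move=> x [x0 xy z0 yz]; have y0 := le_trans x0 xy.
  rewrite /= !in_itv/= x0 z0 /=.
  have yH : x.1.2 / H <= 1 by lra.
  rewrite (le_trans xy yH).
  move: y0 yH; rewrite pmulr_lge0 ?invr_gt0// ler_pdivrMr// mul1r => -> ->.
  by split => //; lra.
- by rewrite leb3_box ?ler01 ?ltW// !subr0 mul1r mulr1.
Qed.

Lemma is_W1p_lc s :
  is_W1p (slab H) p (lc H s) (fun j => 'D_(evec R j) (lc H s)).
Proof.
have Lp s' : is_Lp (slab H) p (lc H s').
  split; first by apply: measurable_funTS; exact: measurable_lc.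
  apply: le_lt_trans (@Lpnorm_slab_le _ (coef_norm s') _ _ _) _.
  - exact: measurable_lc.
  - exact: coef_norm_ge0.
  - by move=> x; exact: lc_bound.
  - exact: ltry.
split => // j; split; first by rewrite derive_lc.
by apply: weak_partial_smooth; [exact: measurable_slab|exact: smooth_lc].
Qed.

Lemma Lpnorm_ufield_le : (Lpnorm (slab H) p (fun x => enorm (fun i => u i x)) <=
  ((\sum_i coef_norm (useq k g i)) * pscale p H)%:E)%E.
Proof.
apply: Lpnorm_slab_le; first last.
- move=> x xS; rewrite ger0_norm ?sqrtr_ge0//.
  apply: (@le_trans _ _ (\sum_i `|u i x|)); last first.
    by apply: ler_sum => i _; rewrite ufieldE lc_bound.
  rewrite -[leRHS]ger0_norm ?sumr_ge0// -sqrtr_sqr ler_sqrt ?sqr_ge0//.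
  rewrite !sum3 -(real_normK (num_real (u 0 x))) -(real_normK (num_real (u 1 x))).
  rewrite -(real_normK (num_real (u 2%:R x))).
  have := normr_ge0 (u 0 x); have := normr_ge0 (u 1 x).
  have := normr_ge0 (u 2%:R x).
  by move: (`|u 0 x|) (`|u 1 x|) (`|u 2%:R x|) => a b e e0 b0 a0; nra.
- by apply: sumr_ge0 => i _; exact: coef_norm_ge0.
- apply: (measurableT_comp (continuous_measurable_fun (@sqrt_continuous R))).
  apply: measurable_sum => i; apply: measurable_funX; rewrite ufieldE.
  exact: measurable_lc.
Qed.

Lemma Lpnorm_derive_ufield_le i j :
  ((sides H j)%:E * Lpnorm (slab H) p ('D_(evec R j) (u i)) <=
   (coef_norm (dlc j (useq k g i)) * pscale p H)%:E)%E.
Proof.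
have s0 : 0 < sides H j by rewrite /sides; case: ifP.
apply: (@le_trans _ _ ((sides H j)%:E *
    ((sides H j)^-1 * coef_norm (dlc j (useq k g i)) * pscale p H)%:E)%E).
  apply: lee_wpmul2l; first by rewrite lee_fin ltW.
  apply: Lpnorm_slab_le.
  - by rewrite ufieldE derive_lc; exact: measurable_lc.
  - by rewrite mulr_ge0 ?coef_norm_ge0// invr_ge0 ltW.
  - move=> x xS; rewrite ufieldE derive_lcE normrM ger0_norm ?invr_ge0 ?(ltW s0)//.
    by apply: ler_wpM2l; rewrite ?invr_ge0 ?(ltW s0)//; exact: lc_bound.
by rewrite -EFinM !mulrA mulfV ?mul1r// gt_eqF.
Qed.

End norms.

Lemma lc_gseq_rescale (R : realType) (k : nat) (g : nat -> R) (H c x y z : R) :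
  H != 0 -> lc H (gseq k g c) (x, y, z) = c * lc 1 (gseq k g 1) (x, y / H, z).
Proof.
move=> Hn0; rewrite /lc !big_map mulr_sumr; apply: eq_bigr => i _.
by rewrite /mon/= !divr1 mul1r !mulrA.
Qed.

Lemma Lpnorm_vfield_ge (R : realType) (k : nat) (g : nat -> R) (p : \bar R) :
  (1 <= p)%E -> (exists2 i, (i <= k)%N & g i != 0) ->
  exists2 a : R, 0 < a & forall H, 0 < H ->
    ((H * a * pscale p H)%:E <= Lpnorm (slab H) p (vfield H k g 1%R))%E.
Proof.
move=> p1 /exists_nonzero_box[x0 [e [del [e0 del0 /andP[ex0 x04] e8 box]]]].
exists (del * e ^+ 2); first by rewrite mulr_gt0// exprn_gt0.
move=> H H0; have Hn0 := lt0r_neq0 H0.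
(* The nonvanishing box stretched by H along x2; the height 1/4 makes its volume exactly e^2 H. *)
pose B : set (R3 R) := (`[x0 - e, x0 + e] `*` `[H * (2^-1 - e), H * (2^-1 + e)])
  `*` `[0, 4^-1].
have mB : measurable B.
  by apply: measurableX; [apply: measurableX|]; exact: measurable_itv.
have muB : (@leb3 R B = (e ^+ 2 * H)%:E)%E.
  rewrite leb3_box ?invr_ge0 ?ler_pM2l//; [|lra|lra].
  by congr EFin; field.
have BP x : B x -> [/\ x0 - e <= x.1.1 <= x0 + e, 2^-1 - e <= x.1.2 / H <= 2^-1 + e &
    0 <= x.2 <= 4^-1].
  move=> [[/= +  +] +]; rewrite !in_itv/= => -> /andP[y1 y2] ->; split => //.
  by rewrite ler_pdivlMr// ler_pdivrMr// ![_ * H]mulrC y1.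
apply: le_trans (@Lpnorm_ge_cst R p (slab H) B _ (H * del) (e ^+ 2 * H) _ _ _ _ _ _ _ _ _) => //.
- rewrite lee_fin.
  have -> : H * (del * e ^+ 2) * pscale p H = H * del * (e ^+ 2 * pscale p H) by ring.
  apply: ler_wpM2l; first by rewrite mulr_ge0 ?ltW.
  rewrite -ler_pdivlMl ?exprn_gt0//.
  (* [pscale_le] with factor e^-2 >= 1 replaces the volume of B by H, at the price of the e^2 in the
     constant a. *)
  have {1}-> : H = e ^- 2 * (e ^+ 2 * H) by rewrite mulKf// expf_neq0// gt_eqF.
  apply: pscale_le => //; last by rewrite mulr_ge0 ?exprn_ge0 ?ltW.
  by rewrite invf_ge1 ?exprn_gt0// exprn_ile1// ?ltW//; lra.
- exact: measurable_slab.
- move=> x /BP[/andP[? ?] /andP[? ?] /andP[? ?]]; split => //; lra.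
- exact: measurable_lc.
- by rewrite mulr_gt0// exprn_gt0.
- by rewrite mulr_ge0 ?ltW.
- move=> [[x y] z] /BP[/= xP yP zP].
  rewrite /vfield/= lc_gseq_rescale// normrM normrN (gtr0_norm H0).
  by rewrite ler_pM2l//; exact: box.
Qed.

Theorem mainTheorem5 (R : realType) (k : nat) (p : \bar R) (hp : (1 <= p)%E) :
  ~ exists C : R,
      forall h : 'I_3 -> R, (forall j, 0 < h j) ->
      forall (u : 'I_3 -> R3 R -> R) (Du : 'I_3 -> 'I_3 -> R3 R -> R)
             (v : 'I_3 -> R3 R -> R),
        let T := tetra (Ttilde h) in
        (forall i, is_W1p T p (u i) (Du i)) ->
        is_RTinterp k (Ttilde h) u Du v ->
        (Lpnorm T p (v 1%R) <=
         C%:E * (Lpnorm T p (fun x => enorm (fun i => u i x))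
                 + \sum_(i < 3) \sum_(j < 3) (h j)%:E * Lpnorm T p (Du i j)
                 + (diam T)%:E * Lpnorm T p (fun x => (\sum_i Du i i x)%R)))%E.
Proof.
move=> [C hC].
have [g g0 Mlt] := hilbert_kernel R k.
have [a a0 vge] := Lpnorm_vfield_ge hp g0.
(* Q gathers the coefficient sums that bound the norms of u and its weighted derivatives, relative
   to [pscale p H]; it does not involve H. *)
pose Q := \sum_i coef_norm (useq k g i) +
  \sum_(i < 3) \sum_(j < 3) coef_norm (dlc j (useq k g i)).
have Q0 : 0 <= Q.
  by rewrite addr_ge0// ?sumr_ge0// => i _; rewrite ?sumr_ge0// => *;
    exact: coef_norm_ge0.
(* Chosen so that H a = |C| Q + a exceeds |C| Q; the absolute value covers a negative C. *)
pose H := `|C| * Q / a + 1.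
have H0 : 0 < H by rewrite ltr_wpDl// divr_ge0 ?mulr_ge0// ltW.
have s0 j : 0 < sides H j by rewrite /sides; case: ifP.
have := hC _ s0 (ufield H k g) (fun i j => 'D_(evec R j) (ufield H k g i))
  (vfield H k g) _ (is_RTinterp_vfield H0 Mlt).
rewrite /= tetra_slab//.
have W i : is_W1p (slab H) p (ufield H k g i)
    (fun j => 'D_(evec R j) (ufield H k g i)).
  by rewrite ufieldE; exact: is_W1p_lc.
move=> /(_ W); apply/negP; rewrite -ltNge.
have -> : Lpnorm (slab H) p
    (fun x => \sum_i 'D_(evec R i) (ufield H k g i) x) = 0%E.
  have -> : (fun x => \sum_i 'D_(evec R i) (ufield H k g i) x) = cst 0.
    by apply/funext => x; exact: div_ufield.
  rewrite /Lpnorm (_ : _ \_ _ = cst 0%E) ?Lnorm0//.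
    by rewrite gt_eqF// (lt_le_trans _ hp).
  by apply/funext => x; rewrite patchE; case: ifP.
rewrite mule0 adde0.
set X := (_ + _)%E.
have X0 : (0 <= X)%E.
  rewrite /X adde_ge0 ?Lnorm_ge0//.
  apply: sume_ge0 => i _; apply: sume_ge0 => j _.
  by rewrite mule_ge0 ?lee_fin ?(ltW (s0 j))//; exact: Lnorm_ge0.
have XQ : (X <= (Q * pscale p H)%:E)%E.
  rewrite /Q mulrDl EFinD; apply: leeD.
    exact: Lpnorm_ufield_le.
  rewrite mulr_suml -sumEFin; apply: lee_sum => i _.
  rewrite mulr_suml -sumEFin; apply: lee_sum => j _.
  exact: Lpnorm_derive_ufield_le.
apply: le_lt_trans (_ : C%:E * X <= (`|C| * Q * pscale p H)%:E)%E _.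
  apply: (@le_trans _ _ (`|C|%:E * X)%E).
    by apply: lee_wpmul2r => //; rewrite lee_fin ler_norm.
  by rewrite -mulrA EFinM; apply: lee_wpmul2l.
apply: lt_le_trans (vge _ H0).
rewrite lte_fin ltr_pM2r ?pscale_gt0//.
by rewrite /H mulrDl mul1r divfK ?gt_eqF// ltrDl.
Qed.
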